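(* Let $W\subset\mathbb R^n$ be a $\rho$-admissible subspace, with associated face $F_W$ of $\mathcal E$. Then $Q_{F_W}=Q(W)$. Moreover, if $\beta\in C_{F_W}^{H_{F_W}}$, then $G^{\beta+}=Q(W)$. Hence $Q(W)$ only depends on the face $F_W$.
   Context: Let $G\subset \mathrm{SL}(n,\mathbb R)$ be a closed connected noncompact semisimple Lie subgroup with Lie algebra $\mathfrak g$ such that $G=K\exp(\mathfrak p)$, where $K=G\cap \mathrm{SO}(n)$, $\mathfrak p=\mathfrak g\cap \mathrm{Sym}_0(n)$ and $\mathrm{Sym}_0(n)$ is the space of trace-zero real symmetric $n\times n$ matrices; let $\mathfrak k$ be the Lie algebra of $K$. Assume that $G$ acts irreducibly on $\mathbb R^n$ and on $\mathbb C^n$ ($\rho$ denotes the inclusion $G\to\mathrm{SL}(n,\mathbb R)$). Let $U\subset\mathrm{SU}(n)$ be the compact connected semisimple subgroup with Lie algebra $\mathfrak u=\mathfrak k\oplus i\mathfrak p$, and let $U^{\mathbb C}\subset\mathrm{SL}(n,\mathbb C)$ be its complexification (the Zariski closure of $G$). $\mathcal O'$ denotes the unique compact $U^{\mathbb C}$-orbit in $\mathbb P(\mathbb C^n)$ and $\mathcal O$ the unique compact $G$-orbit in $\mathcal O'$ (it is also a $K$-orbit, contained in $\mathbb P(\mathbb R^n)$). Fix an $\mathrm{Ad}(\mathrm{SU}(n))$-invariant scalar product $\langle\cdot,\cdot\rangle$ on $i\mathfrak{su}(n)\supset\mathfrak p$. The $G$-gradient map $\mu_{\mathfrak p}:\mathbb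 P(\mathbb C^n)\to\mathfrak p$ is defined by $\langle\mu_{\mathfrak p}([z]),\beta\rangle=\frac{z^*\beta z}{\|z\|^2}$ for all $\beta\in\mathfrak p$; it is $K$-equivariant. Let $\mathcal E=\mathrm{conv}(\mu_{\mathfrak p}(\mathcal O))=\mathrm{conv}(\mu_{\mathfrak p}(\mathbb P(\mathbb R^n)))\subset\mathfrak p$ and, for $\beta\in\mathfrak p$, $F_\beta(\mathcal E)=\{p\in\mathcal E:\ \langle p,\beta\rangle=\max_{y\in\mathcal E}\langle y,\beta\rangle\}$. For a face $F$ of $\mathcal E$: $\mathrm{ext}\,F$ is its set of extreme points, $H_F=\{k\in K:\ \mathrm{Ad}(k)F=F\}$, $C_F=\{\beta\in\mathfrak p:\ F=F_\beta(\mathcal E)\}$, and $C_F^{H_F}$ is the set of elements of $C_F$ fixed by $H_F$. For $\beta\in\mathfrak p$, $G^{\beta+}=\{g\in G:\ \lim_{t\to-\infty}\exp(t\beta)g\exp(-t\beta)\text{ exists}\}$; the parabolic subgroups of $G$ are exactly the groups $G^{\beta+}$, $\beta\in\mathfrak p$. A subspace $W\subset\mathbb R^n$ is called $\rho$-admissible (also: $\rho$-connected) if $Q(W)=\{g\in G:\ gW=W\}$ is a parabolic subgroup of $G$ and $Q(W)$ acts irreducibly on $W$. If $Q(W)=G^{\beta+}$, then $F_W:=F_\beta(\mathcal E)$, and $\mathrm{ext}\,F_W=\mu_{\mathfrak p}(\mathbb P(W)\cap\mathcal O)$. The set $\mu_{\mathfrak p}(\mathcal O)$ is a single $\mathrm{Ad}(K)$-orbit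 and the $K$-action on it extends to a $G$-action: for $x\in\mu_{\mathfrak p}(\mathcal O)$ one has $G=KG^{x+}$ and $K\cap G^{x+}=K^x$ (stabilizer of $x$ in $K$), so $K\cdot x\cong G/G^{x+}$, i.e. $g\cdot(\mathrm{Ad}(k)x)=\mathrm{Ad}(k')x$ whenever $gk\in k'G^{x+}$. Since $\mathrm{ext}\,F_W\subset\mu_{\mathfrak p}(\mathcal O)$, one can define $Q_{F_W}=\{h\in G:\ h\,\mathrm{ext}\,F_W=\mathrm{ext}\,F_W\}$. *)

(* Defs.v *)
From HB Require Import structures.
From mathcomp Require Import all_boot all_order all_algebra.
From mathcomp Require Import all_classical all_reals all_analysis.
From mathcomp Require Import complex.
From mathcomp Require mpoly.

Set Implicit Arguments.
Unset Strict Implicit.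
Unset Printing Implicit Defensive.

Import Order.TTheory GRing.Theory Num.Theory.
Import numFieldNormedType.Exports.
Import ComplexField.

Local Open Scope classical_set_scope.
Local Open Scope ring_scope.
Local Open Scope sesquilinear_scope.
Local Open Scope quotient_scope.

(* Packing R[i] as a numClosedFieldType gives it the topology of its modulus. *)
Definition Cplx (R : rcfType) : numClosedFieldType := R[i]%C.

Definition toC (R : rcfType) : R -> Cplx R := real_complex R.

Definition cplx_mx (R : rcfType) (m n : nat) (A : 'M[R]_(m, n)) :
  'M[Cplx R]_(m, n) := map_mx (@toC R) A.

Section Projective.
Variables (K : numClosedFieldType) (n : nat).

Definition nonzero_vec : set 'cV[K]_n := [set z | z != 0].

Definition same_line (z w : nonzero_vec) : bool :=
  `[< exists a : K, set_val z = a *: set_val w >].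

Lemma same_line_refl : reflexive same_line.
Proof. by move=> z; apply/asboolP; exists 1; rewrite scale1r. Qed.

Lemma same_line_sym : symmetric same_line.
Proof.
suff H z w : same_line z w -> same_line w z by move=> z w; apply/idP/idP; apply: H.
move=> /asboolP[a zw]; apply/asboolP; exists a^-1.
have z0 : set_val z != 0 by exact: set_mem (valP z).
have a0 : a != 0 by apply: contraNneq z0 => a0; rewrite zw a0 scale0r.
by rewrite zw scalerA mulVf // scale1r.
Qed.

Lemma same_line_trans : transitive same_line.
Proof.
move=> w z u /asboolP[a zw] /asboolP[b wu]; apply/asboolP; exists (a * b).
by rewrite zw wu scalerA.
Qed.

Canonical same_line_equiv :=
  EquivRel same_line same_line_refl same_line_sym same_line_trans.

Definition projective_space := quotient_topology {eq_quot same_line}.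

Definition line_of (z : nonzero_vec) : projective_space :=
  \pi_projective_space z.

Definition proj_orbit (S : set 'M[K]_n) (x : projective_space) :
    set projective_space :=
  [set y | exists g z w, [/\ S g, x = line_of z, y = line_of w
                           & set_val w = g *m set_val z]].

Definition compact_proj_orbit (S : set 'M[K]_n) (O : set projective_space) :=
  compact O /\ exists x, O = proj_orbit S x.

End Projective.

Definition act_vspace (F : fieldType) (n : nat) (g : 'M[F]_n)
    (W : {vspace 'cV[F]_n}) : {vspace 'cV[F]_n} :=
  (linfun (mulmx g : 'cV[F]_n -> 'cV[F]_n) @: W)%VS.

Definition irreducible_on (F : fieldType) (n : nat) (S : set 'M[F]_n)
    (W : {vspace 'cV[F]_n}) : Prop :=
  W <> 0%VS /\
  forall V : {vspace 'cV[F]_n}, (V <= W)%VS ->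
    (forall g, S g -> (act_vspace g V <= V)%VS) -> V = 0%VS \/ V = W.

Definition Ad (F : fieldType) (n : nat) (g X : 'M[F]_n) : 'M[F]_n :=
  g *m X *m invmx g.

Section Semisimple.
Variables (F : fieldType) (n : nat).

Definition bracket (X Y : 'M[F]_n) : 'M[F]_n := X *m Y - Y *m X.

Definition derived_alg (I : {vspace 'M[F]_n}) : {vspace 'M[F]_n} :=
  <<[seq bracket X Y | X <- vbasis I, Y <- vbasis I]>>%VS.

Definition lie_solvable (I : {vspace 'M[F]_n}) : Prop :=
  exists k : nat, iter k derived_alg I = 0%VS.

Definition lie_ideal (g : set 'M[F]_n) (I : {vspace 'M[F]_n}) : Prop :=
  (forall Y, Y \in I -> g Y) /\
  (forall X Y, g X -> Y \in I -> bracket X Y \in I).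

Definition lie_semisimple (g : set 'M[F]_n) : Prop :=
  forall I, lie_ideal g I -> lie_solvable I -> I = 0%VS.

End Semisimple.

Section Groups.
Variables (R : realType) (n : nat).
Implicit Types (G : set 'M[R]_n) (W : {vspace 'cV[R]_n}).

Definition expmx (X : 'M[R]_n) : 'M[R]_n :=
  limn (series (fun k => (k`!%:R)^-1 *: X ^+ k)).

Definition subgroup_of_SL G : Prop :=
  [/\ G 1%:M,
      forall g h, G g -> G h -> G (g *m h),
      forall g, G g -> G (invmx g)
    & forall g, G g -> \det g = 1].

Definition lie_algebra G : set 'M[R]_n := [set X | forall t : R, G (expmx (t *: X))].

Definition SOn : set 'M[R]_n := [set k | k^T *m k = 1%:M /\ \det k = 1].

Definition Sym0 : set 'M[R]_n := [set X | X^T = X /\ \tr X = 0].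

Definition compactK G : set 'M[R]_n := G `&` SOn.

Definition sym_part G : set 'M[R]_n := lie_algebra G `&` Sym0.

(* Zariski closure of G in the complex matrices.  It lies in SL(n, C), since
   \det - 1 is a polynomial in the entries that vanishes on G. *)
Definition zariski_closureC G : set 'M[Cplx R]_n :=
  [set h | forall P : mpoly.mpoly (n * n) (Cplx R),
     (forall g, G g -> mpoly.meval (fun i => mxvec (cplx_mx g) 0 i) P = 0) ->
     mpoly.meval (fun i => mxvec h 0 i) P = 0].

Definition stabilizer G W : set 'M[R]_n := G `&` [set g | act_vspace g W = W].

(* The limit, taken among all matrices, lies in G when G is closed in SL(n, R). *)
Definition Gplus G (b : 'M[R]_n) : set 'M[R]_n :=
  G `&` [set g | cvg ((fun t : R => expmx (t *: b) *m g *m expmx (- t *: b))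
                        @ -oo)].

Definition parabolic G (Q : set 'M[R]_n) : Prop :=
  exists2 b, sym_part G b & Q = Gplus G b.

Definition rho_admissible G W : Prop :=
  parabolic G (stabilizer G W) /\ irreducible_on (stabilizer G W) W.

(* Elements of i su(n) are the trace-zero Hermitian matrices. *)
Definition isu : set 'M[Cplx R]_n := [set X | X \is hermsymmx /\ \tr X = 0].

Definition SUn : set 'M[Cplx R]_n := [set u | u \is unitarymx /\ \det u = 1].

Definition Ad_invariant_scalar_product (dot : 'M[Cplx R]_n -> 'M[Cplx R]_n -> R) :
    Prop :=
  [/\ forall (a : R) X Y Z, isu X -> isu Y -> isu Z ->
        dot (toC a *: X + Y) Z = a * dot X Z + dot Y Z,
      forall X Y, isu X -> isu Y -> dot X Y = dot Y X,
      forall X, isu X -> X != 0 -> 0 < dot X X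
    & forall u X Y, SUn u -> isu X -> isu Y -> dot (Ad u X) (Ad u Y) = dot X Y].

Definition gradient_map G (dot : 'M[Cplx R]_n -> 'M[Cplx R]_n -> R)
    (mu : projective_space (Cplx R) n -> 'M[R]_n) : Prop :=
  forall z : nonzero_vec (K := Cplx R) (n := n),
    sym_part G (mu (line_of z)) /\
    forall b, sym_part G b ->
      toC (dot (cplx_mx (mu (line_of z))) (cplx_mx b)) =
      ((set_val z)^t* *m cplx_mx b *m set_val z) 0 0
        / ((set_val z)^t* *m set_val z) 0 0.

Definition conv_hull (S : set 'M[R]_n) : set 'M[R]_n :=
  smallest (@convex_set R 'M[R]_n) S.

Definition extreme_points (F : set 'M[R]_n) : set 'M[R]_n :=
  [set x | F x /\ forall y z (t : R), F y -> F z -> 0 < t < 1 ->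
             x = t *: y + (1 - t) *: z -> y = x /\ z = x].

Definition exposed_face (dot : 'M[Cplx R]_n -> 'M[Cplx R]_n -> R)
    (E : set 'M[R]_n) (b : 'M[R]_n) : set 'M[R]_n :=
  [set x | E x /\ forall y, E y ->
             dot (cplx_mx y) (cplx_mx b) <= dot (cplx_mx x) (cplx_mx b)].

(* F is F_W, computed from some b with Q(W) = G^{b+}. *)
Definition associated_face G (dot : 'M[Cplx R]_n -> 'M[Cplx R]_n -> R)
    (E : set 'M[R]_n) W (F : set 'M[R]_n) : Prop :=
  exists b, [/\ sym_part G b, stabilizer G W = Gplus G b & F = exposed_face dot E b].

Definition H_face G (F : set 'M[R]_n) : set 'M[R]_n :=
  compactK G `&` [set k | Ad k @` F = F].

Definition C_face G (dot : 'M[Cplx R]_n -> 'M[Cplx R]_n -> R)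
    (E F : set 'M[R]_n) : set 'M[R]_n :=
  sym_part G `&` [set b | F = exposed_face dot E b].

Definition C_face_fixed G (dot : 'M[Cplx R]_n -> 'M[Cplx R]_n -> R)
    (E F : set 'M[R]_n) : set 'M[R]_n :=
  C_face G dot E F `&` [set b | forall k, H_face G F k -> Ad k b = b].

(* The G-action on S = mu(O), a single Ad(K)-orbit: g . Ad(k) x = Ad(k') x
   whenever g k is in k' G^{x+}.  The value is junk (namely y) off S. *)
Definition Korbit_action G (S : set 'M[R]_n) (g y : 'M[R]_n) : 'M[R]_n :=
  xget y [set y' | exists x k k',
    [/\ S x, compactK G k, compactK G k', y = Ad k x & y' = Ad k' x /\
        exists2 q, Gplus G x q & g *m k = k' *m q]].

Definition Q_face G (S F : set 'M[R]_n) : set 'M[R]_n :=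
  G `&` [set h | Korbit_action G S h @` extreme_points F = extreme_points F].

End Groups.

(* Main.v *)
Require Import Defs.
From HB Require Import structures.
From mathcomp Require Import fingroup perm all_boot all_order all_algebra.
From mathcomp Require Import all_classical all_reals all_analysis.
From mathcomp Require Import complex ring lra.

(** Everything is read off in an orthonormal eigenframe of a symmetric matrix [b]
    of [p], with eigenvalues [d_i]. There, conjugation by [exp (t b)] multiplies the
    entry [(i, j)] by [exp (t (d_i - d_j))], so that [G^{b+}] consists of the block
    triangular elements of [G] ([GplusP]); it preserves the sums of the eigenspaces
    of the largest eigenvalues. A limiting argument on the polar decompositions of
    [g exp (m b)] gives [G = K G^{b+}] ([iwasawa]).

    The moments. For [Y] in [p], the height [<mu, Y>] is at most the largest
    eigenvalue of [Y], with equality exactly on the leading eigenspace of [Y]. As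
    the orbit [O] spans [C^n], flowing by [exp (t Y)] shows that this bound is
    attained on [O] ([orbit_top]). Take a point of [O] whose moment [x] has maximal
    norm. The points of [O] with moment [x] are then those where the height of [x]
    is maximal, that is those in the leading eigenspace of [x], and they are
    permuted by [G^{x+}]. Since [G = K G^{x+}], the set [mu(O)] is a single
    [K]-orbit, on a sphere, and [mu] intertwines the action of [G] on [O] with its
    action on [mu(O)] ([Korbit_action_moment]). Since [mu(O)] lies on a sphere,
    the extreme points of [F_b(E)] are the moments of the set [T] of points of [O]
    in the leading eigenspace of [b] ([extreme_face]).

    The subspace. The key point is that an admissible [W] with [Q(W) = G^{b+}] is
    the leading eigenspace of [b] ([admissible_top]). Irreducibility puts [W] into
    one eigenspace. If [g] is close to [1], then [exp (m b) g = k_m q_m] with [q_m]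
    in [Q(W)] and the cluster points of the [k_m] in [Q(W)], so the subspaces
    [exp (m b) g W = k_m W] accumulate at [W]; comparing leading terms, the
    components of [g W] in the eigenspaces from that of [W] upwards lie in [W].
    As the [g W] with [g] close to [1] span [R^n], by connectedness and
    irreducibility of [G], there is nothing above or beside [W].

    The conclusion. An element [h] of [G] that preserves [ext F_W] preserves [T],
    hence the real span of [T], a nonzero subspace of [W] stable under the
    irreducible action of [Q(W)]; this span is [W], and [h] is in [Q(W)]
    ([top_stable_stabilizer]). Conversely [Q(W) = G^{b+}] preserves [T]. If
    another [b'] defines the same face, then [G^{b'+}] preserves [T] too, so it is
    contained in [Q(W)], and [Q(W) = (K cap Q(W)) G^{b'+}]. The elements of
    [K cap Q(W)] are orthogonal and block triangular, so they commute with [b] and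
    preserve [F_W]; when [b'] is fixed by them, [Q(W)] is contained in [G^{b'+}]
    ([C_face_fixed_Gplus]). *)

Set Implicit Arguments.
Unset Strict Implicit.
Unset Printing Implicit Defensive.

Import Order.TTheory GRing.Theory Num.Theory.
Import numFieldNormedType.Exports.

Local Open Scope classical_set_scope.
Local Open Scope ring_scope.
Local Open Scope sesquilinear_scope.

(** * Limits of matrices and the real spectral theorem *)

Lemma cvg_mxP (K : numFieldType) (T : Type) (F : set_system T) {FF : Filter F}
    (m n : nat) (f : T -> 'M[K]_(m, n)) (M : 'M[K]_(m, n)) :
  f @ F --> M <-> forall i j, (fun x => f x i j) @ F --> M i j.
Proof.
split=> [fM i j|fM].
  exact: (cvg_comp f (fun N : 'M[K]_(m, n) => N i j) fM (@coord_continuous K m n i j M)).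
move=> A [P MP PA]; rewrite /nbhs /=.
suff : \forall x \near F, forall i j, P i j (f x i j) by apply: filterS => x /PA.
by apply: filter_forall => i; apply: filter_forall => j; exact: fM (MP i j).
Qed.

Lemma normed_cvg_unique (K : numFieldType) (V : pseudoMetricNormedZmodType K) (T : Type)
    (F : set_system T) {FF : ProperFilter F} (f : T -> V) (a l : V) :
  f @ F --> a -> f @ F --> l -> a = l.
Proof. exact: (cvg_unique (@norm_hausdorff _ _)). Qed.

Lemma cvg_cst_eq (K : numFieldType) (V : pseudoMetricNormedZmodType K) (T : Type)
    (F : set_system T) {FF : ProperFilter F} (a l : V) :
  (fun=> a) @ F --> l -> a = l.
Proof. by apply: normed_cvg_unique; exact: cvg_cst. Qed.

Lemma cvg_finsum (K : numFieldType) (T I : Type) (F : set_system T) {FF : Filter F}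
    (r : seq I) (f : I -> T -> K) (l : I -> K) :
  (forall i, f i @ F --> l i) ->
  (fun x => \sum_(i <- r) f i x) @ F --> \sum_(i <- r) l i.
Proof.
move=> fl; elim: r => [|i r IH].
  by under eq_fun do rewrite big_nil; rewrite big_nil; exact: cvg_cst.
by under eq_fun do rewrite big_cons; rewrite big_cons; exact: cvgD.
Qed.

Lemma cvg_mulmx (K : numFieldType) (T : Type) (F : set_system T) {FF : ProperFilter F}
    (m n p : nat) (f : T -> 'M[K]_(m, n)) (g : T -> 'M[K]_(n, p))
    (M : 'M[K]_(m, n)) (N : 'M[K]_(n, p)) :
  f @ F --> M -> g @ F --> N -> (fun x => f x *m g x) @ F --> M *m N.
Proof.
move=> /cvg_mxP fM /cvg_mxP gN; apply/cvg_mxP => i j.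
rewrite mxE (_ : (fun x => _) = fun x => \sum_k f x i k * g x k j); last first.
  by apply/funext => x; rewrite mxE.
by apply: cvg_finsum => k; exact: cvgM.
Qed.

Lemma cvg_trmx (K : numFieldType) (T : Type) (F : set_system T) {FF : ProperFilter F}
    (m n : nat) (f : T -> 'M[K]_(m, n)) (M : 'M[K]_(m, n)) :
  f @ F --> M -> (fun x => (f x)^T) @ F --> M^T.
Proof.
move=> /cvg_mxP fM; apply/cvg_mxP => i j; rewrite mxE.
by rewrite (_ : (fun x => _) = fun x => f x j i) //; apply/funext => x; rewrite mxE.
Qed.

Section Orthogonal.
Variable R : rcfType.

Definition orthogonalmx n (U : 'M[R]_n) := U^T *m U = 1%:M /\ U *m U^T = 1%:M.

Lemma orthogonalmxP n (U : 'M[R]_n) : U^T *m U = 1%:M -> orthogonalmx U.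
Proof. by move=> UU; split=> //; exact: mulmx1C. Qed.

Lemma orthogonalmx_tr n (U : 'M[R]_n) : orthogonalmx U -> orthogonalmx U^T.
Proof. by case=> h1 h2; split; rewrite trmxK. Qed.

Lemma orthogonalmxM n (U V : 'M[R]_n) :
  orthogonalmx U -> orthogonalmx V -> orthogonalmx (U *m V).
Proof.
move=> [U1 _] [V1 _]; apply: orthogonalmxP.
by rewrite trmx_mul mulmxA -(mulmxA _ U^T) U1 mulmx1.
Qed.

Lemma orthogonal_row n (U : 'M[R]_n) i : orthogonalmx U -> \sum_j U i j ^+ 2 = 1.
Proof.
move=> [_ /matrixP/(_ i i)]; rewrite !mxE eqxx mulr1n => UU; rewrite -[RHS]UU.
by apply: eq_bigr => j _; rewrite mxE expr2.
Qed.

Lemma orthogonal_col n (U : 'M[R]_n) j : orthogonalmx U -> \sum_i U i j ^+ 2 = 1.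
Proof.
move=> /orthogonalmx_tr/(orthogonal_row j) UT; rewrite -[RHS]UT.
by apply: eq_bigr => i _; rewrite mxE.
Qed.

Lemma orthogonal_le1 n (U : 'M[R]_n) i j : orthogonalmx U -> `|U i j| <= 1.
Proof.
move=> /(orthogonal_row i) U1.
rewrite -(@ler_pXn2r _ 2) ?nnegrE // expr1n -[leRHS]U1 (bigD1 j) //= real_normK ?num_real //.
by rewrite lerDl sumr_ge0 // => l _; exact: sqr_ge0.
Qed.

Definition sqnorm n (v : 'rV[R]_n) : R := \sum_i v 0 i ^+ 2.

Lemma mul_tr_sqnorm n (v : 'rV[R]_n) : v *m v^T = (sqnorm v)%:M.
Proof.
apply/matrixP => i j; rewrite !ord1 !mxE eqxx mulr1n.
by apply: eq_bigr => k _; rewrite mxE expr2.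
Qed.

Lemma sqnorm_gt0 n (v : 'rV[R]_n) : v != 0 -> 0 < sqnorm v.
Proof.
move=> v0; rewrite lt_neqAle eq_sym sumr_ge0 ?andbT; last by move=> i _; exact: sqr_ge0.
apply: contraNneq v0 => /eqP; rewrite psumr_eq0; last by move=> i _; exact: sqr_ge0.
move=> /allP v0; apply/eqP/rowP => i; rewrite mxE; apply/eqP.
by have /= := v0 i (mem_index_enum _); rewrite sqrf_eq0.
Qed.

(** If [v] is not the first basis vector, take the reflection exchanging the two. *)
Lemma householder n (v : 'rV[R]_n.+1) : sqnorm v = 1 ->
  exists2 H : 'M[R]_n.+1, orthogonalmx H & row 0 H = v.
Proof.
move=> v1; pose e : 'rV[R]_n.+1 := delta_mx 0 0.
have e1 : sqnorm e = 1.
  rewrite /sqnorm (bigD1 0) //= mxE !eqxx expr1n big1 ?addr0 // => i i0.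
  by rewrite mxE (negbTE i0) andbF expr0n.
have [->|ve] := eqVneq v e.
  by exists 1%:M; [split; rewrite trmx1 mulmx1 | rewrite row1].
pose u := v - e; have u0 : u != 0 by rewrite subr_eq0.
have su := sqnorm_gt0 u0.
have ev : v *m e^T = e *m v^T.
  by rewrite -{1}[v]trmxK -trmx_mul; apply/matrixP => i j; rewrite !ord1 mxE.
have [x ex] : exists x, e *m v^T = x%:M by exists ((e *m v^T) 0 0); rewrite -mx11_scalar.
have su2 : sqnorm u = 2 - 2 * x.
  have : (sqnorm u)%:M = 1%:M - x%:M - (x%:M - 1%:M) :> 'M[R]_1.
    by rewrite -mul_tr_sqnorm /u linearB /= mulmxBl !mulmxBr !mul_tr_sqnorm v1 e1 ev ex.
  move=> /(congr1 (fun M : 'M[R]_1 => M 0 0)); rewrite !mxE /= !mulr1n => ->.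
  by ring.
have eu : e *m u^T = (- (sqnorm u / 2))%:M.
  rewrite /u linearB /= mulmxBr mul_tr_sqnorm e1 ex -/u su2 -raddfB /=; congr _%:M.
  by field.
pose N := u^T *m u; pose c := 2 / sqnorm u.
have NN : N *m N = sqnorm u *: N.
  by rewrite /N mulmxA -(mulmxA u^T) mul_tr_sqnorm mul_mx_scalar -scalemxAl.
pose H := 1%:M - c *: N.
have HT : H^T = H by rewrite /H linearB /= linearZ /= trmx1 trmx_mul trmxK.
exists H.
  apply: orthogonalmxP; rewrite HT {1}/H mulmxBl mul1mx -scalemxAl /H mulmxBr mulmx1.
  rewrite -scalemxAr NN scalerBr !scalerA (_ : c * c * sqnorm u = c + c); last first.
    by rewrite /c; field; rewrite gt_eqF.
  by rewrite scalerDl opprB addrK subrK.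
rewrite rowE -/e /H mulmxBr mulmx1 -scalemxAr /N mulmxA eu mul_scalar_mx scalerA.
rewrite (_ : c * _ = -1); last by rewrite /c; field; rewrite gt_eqF.
by rewrite scaleN1r opprK addrC subrK.
Qed.
End Orthogonal.


HB.instance Definition _ (R : rcfType) := GRing.RMorphism.copy (@toC R) (real_complex R).

Section Spectral.
Variable R : rcfType.

(** The eigenvalues of the complexification are real because it is Hermitian, so
    the characteristic polynomial has a real root. *)
Lemma symmetric_eigenvector n (A : 'M[R]_n.+1) : A^T = A ->
  exists l (v : 'rV[R]_n.+1), sqnorm v = 1 /\ v *m A = l *: v.
Proof.
move=> AT; pose B : 'M[Cplx R]_n.+1 := cplx_mx A.
have Bsym : B \is hermsymmx.
  apply: realsym_hermsym.
    apply/is_hermitianmxP; rewrite expr0 scale1r map_mx_id //.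
    by rewrite /B /cplx_mx map_trmx AT.
  by apply/mxOverP => i j; rewrite mxE; apply/complex_realP; exists (A i j).
have /orthomx_spectralP BE := hermitian_normalmx Bsym.
have /mxOverP/(_ 0 0) := hermitian_spectral_diag_real Bsym.
have Punit := spectral_unit B.
set P := spectralmx B in BE Punit *; set D := spectral_diag B in BE *.
move=> /complex_realP[l lE].
have : eigenvalue B (toC l).
  apply/eigenvalueP; exists (row 0 P).
    by rewrite BE !mulmxA -row_mul mulmxV // row1 -rowE row_diag_mx lE -scalemxAl -rowE.
  apply: contraTneq Punit => P0; rewrite unitmxE unitfE negbK; apply/det0P.
  exists (delta_mx 0 0); last by rewrite -rowE.
  by apply/eqP => /rowP/(_ 0)/eqP; rewrite !mxE eqxx oner_eq0.
rewrite eigenvalue_root_char /B /cplx_mx -map_char_poly fmorph_root.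
rewrite -eigenvalue_root_char => /eigenvalueP[v vA v0].
have sv := sqnorm_gt0 v0.
exists l, ((Num.sqrt (sqnorm v))^-1 *: v); split; last by rewrite -scalemxAl vA !scalerA mulrC.
rewrite /sqnorm; under eq_bigr do rewrite mxE exprMn.
by rewrite -mulr_sumr exprVn sqr_sqrtr ?ltW // mulVf // gt_eqF.
Qed.

(** Deflation: a Householder reflection carries a unit eigenvector to the first
    basis vector and leaves a symmetric matrix of smaller size. *)
Theorem spectral_theorem n (A : 'M[R]_n) : A^T = A ->
  exists (U : 'M[R]_n) (d : 'rV[R]_n),
    orthogonalmx U /\ A = U^T *m diag_mx d *m U.
Proof.
elim: n A => [|n IH] A AT.
  exists 1%:M, 0; split; first by split; rewrite trmx1 mulmx1.
  by apply/matrixP => -[].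
have [l [v [v1 vA]]] := symmetric_eigenvector AT.
have [H [H1 H2] Hv] := householder v1.
have [B Bdef] : exists B : 'M[R]_(1 + n), B = H *m A *m H^T by eexists.
have BT : B^T = B by rewrite Bdef !trmx_mul trmxK AT mulmxA.
have row0B : row 0 B = l *: delta_mx 0 0.
  by rewrite Bdef !row_mul Hv vA -scalemxAl -Hv -row_mul H2 row1.
have B0 j : B 0 j = l *+ (j == 0).
  by have /rowP/(_ j) := row0B; rewrite mxE => ->; rewrite mxE mxE eqxx mulr_natr.
have ls0 : lshift n 0 = 0 :> 'I_(1 + n) by exact: val_inj.
have BE : B = block_mx l%:M 0 0 (drsubmx B).
  rewrite -{1}[B]submxK; congr block_mx; apply/matrixP => i j; rewrite !mxE.
  - by rewrite !ord1 ls0 B0 eqxx.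
  - by rewrite ord1 ls0 B0.
  - by rewrite -BT mxE ord1 ls0 B0.
have B'T : (drsubmx B)^T = drsubmx B by rewrite -{2}BT; apply/matrixP => i j; rewrite !mxE.
have [V [d [[V1 V2] Bd]]] := IH _ B'T.
pose V' : 'M[R]_(1 + n) := block_mx 1%:M 0 0 V.
have oV' : orthogonalmx V'.
  by apply: orthogonalmxP; rewrite /V' tr_block_mx !trmx0 trmx1 mulmx_block
    !mulmx0 !mul0mx !addr0 !add0r mulmx1 V1 -scalar_mx_block.
exists (V' *m H), (row_mx l%:M d); split; first exact: orthogonalmxM.
suff -> : A = (V' *m H)^T *m block_mx l%:M 0 0 (diag_mx d) *m (V' *m H).
  have := diag_mx_row (l%:M : 'rV_1) d.
  rewrite (_ : diag_mx l%:M = l%:M) => [<- //|].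
  by apply/matrixP => i j; rewrite !ord1 !mxE.
rewrite trmx_mul !mulmxA -(mulmxA H^T) -(mulmxA H^T).
rewrite (_ : V'^T *m _ *m V' = B).
  by rewrite Bdef !mulmxA H1 mul1mx -mulmxA H1 mulmx1.
rewrite BE /V' tr_block_mx !trmx0 trmx1 !mulmx_block.
by rewrite !(mulmx0, mul0mx, addr0, add0r) mulmx1 mul1mx -Bd.
Qed.
End Spectral.

(** * Ultrafilters on the integers, eigenframes and the matrix exponential *)

Section Limits.
Variable R : realType.

Lemma cvg_expR_Ny (T : Type) (F : set_system T) {FF : Filter F} (f : T -> R) :
  f @ F --> -oo -> (fun x => expR (f x)) @ F --> 0.
Proof.
move=> fF; have Nf : (fun x => - f x) @ F --> +oo by apply/cvgNry.
have := cvg_comp _ _ Nf (@cvgr_expR R).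
by rewrite (_ : _ \o _ = fun x => expR (f x)) //; apply/funext => x /=; rewrite opprK.
Qed.

Lemma cvg_expR_linear_Ny (c : R) : 0 < c -> expR (t * c) @[t --> -oo] --> 0.
Proof.
move=> c0; apply: cvg_expR_Ny; apply/cvgrNyPle => A; near=> t.
rewrite -ler_pdivlMr //; near: t; apply: nbhs_ninfty_le; exact: num_real.
Unshelve. all: by end_near. Qed.

Lemma cvg_expR_nat (F : set_system nat) {FF : Filter F} (c : R) :
  \oo `<=` F -> c < 0 -> (fun m : nat => expR (m%:R * c)) @ F --> 0.
Proof.
move=> ooF c0 A /= A0; apply: ooF.
suff : (fun m : nat => expR (m%:R * c)) @ \oo --> 0 by exact.
apply: cvg_expR_Ny; apply/cvgrNyPle => B; near=> m.
rewrite -ler_ndivrMr //; near: m.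
by have /cvgryPge := @cvgr_idn R; exact.
Unshelve. all: by end_near. Qed.

(** Compactness is used through ultrafilters finer than the filter of cofinite
    sets: along such a filter all bounded sequences converge at once, and no
    subsequence has to be extracted. *)
Lemma ultra_nat : exists F : set_system nat, UltraFilter F /\ \oo `<=` F.
Proof. exact: ultraFilterLemma. Qed.

Lemma fmap_ultra (T S : Type) (f : T -> S) (F : set_system T) :
  UltraFilter F -> UltraFilter (f @ F).
Proof.
move=> FF; split=> [|G GG FG]; first exact: fmap_proper_filter.
apply/seteqP; split=> // A GA.
have [//|FnA] := in_ultra_setVsetC (f @^-1` A) FF.
have GnA : G (~` A) by apply: FG; rewrite /= /nbhs /= preimage_setC.
by have /filter_ex [? []] : G (A `&` ~` A) by exact: filterI.
Qed.

Lemma cvg_ultra_bounded (F : set_system nat) (FF : UltraFilter F) (u : nat -> R) (M : R) :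
  (forall m, `|u m| <= M) -> exists l : R, u @ F --> l.
Proof.
move=> uM; have := @segment_compact R (- M) M; rewrite compact_ultra /=.
move=> cM; have uF : (u @ F) `[- M, M]%classic.
  rewrite /nbhs /= (_ : _ @^-1` _ = setT); first exact: filterT.
  by apply/seteqP; split=> // m _; rewrite /= in_itv /= -ler_norml.
by have [l [_ ul]] := cM (u @ F) (fmap_ultra u FF) uF; exists l.
Qed.

End Limits.

Section Frames.
Variables (R : realType) (n : nat).
Implicit Types (U g : 'M[R]_n) (d : 'rV[R]_n).

(** The rows of [U] are an orthonormal eigenbasis of [b]. The frame is kept as a
    datum, not as a choice, so that several symmetric matrices can be followed. *)
Definition framed U d (b : 'M[R]_n) := orthogonalmx U /\ b = U^T *m diag_mx d *m U.

Definition frame_coords U g : 'M[R]_n := U *m g *m U^T.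

Lemma frame_coordsM U g h : orthogonalmx U ->
  frame_coords U (g *m h) = frame_coords U g *m frame_coords U h.
Proof.
by move=> [U1 _]; rewrite /frame_coords !mulmxA -(mulmxA _ U^T) U1 mulmx1.
Qed.

Lemma frame_coordsK U g : orthogonalmx U -> U^T *m frame_coords U g *m U = g.
Proof.
by move=> [U1 _]; rewrite /frame_coords !mulmxA U1 mul1mx -mulmxA U1 mulmx1.
Qed.

Lemma frame_coordsT U g : (frame_coords U g)^T = frame_coords U g^T.
Proof. by rewrite /frame_coords !trmx_mul trmxK mulmxA. Qed.

Lemma frame_coords_conj U g : orthogonalmx U -> frame_coords U (U^T *m g *m U) = g.
Proof.
by move=> [_ U1]; rewrite /frame_coords !mulmxA U1 mul1mx -mulmxA U1 mulmx1.
Qed.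

Lemma framedZ U d b t : framed U d b -> framed U (t *: d) (t *: b).
Proof. by move=> [U1 ->]; split=> //; rewrite linearZ /= -scalemxAr -scalemxAl. Qed.

Lemma framed_sym U d b : framed U d b -> b^T = b.
Proof. by move=> [_ ->]; rewrite !trmx_mul trmxK tr_diag_mx mulmxA. Qed.

Lemma cvg_frame_coords (T : Type) (F : set_system T) {FF : ProperFilter F} U
    (f : T -> 'M[R]_n) (M : 'M[R]_n) :
  f @ F --> M -> (fun x => frame_coords U (f x)) @ F --> frame_coords U M.
Proof.
by move=> fM; apply: cvg_mulmx; [apply: cvg_mulmx => //; exact: cvg_cst|exact: cvg_cst].
Qed.

Definition exp_row d : 'rV[R]_n := map_mx expR d.

Lemma expmx_framed U d b : framed U d b -> framed U (exp_row d) (expmx b).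
Proof.
move=> [U1 ->]; split=> //; apply: cvg_lim; first exact: norm_hausdorff.
have powE k : (U^T *m diag_mx d *m U) ^+ k = U^T *m diag_mx (map_mx (fun x => x ^+ k) d) *m U.
  elim: k => [|k IH].
    rewrite expr0 (_ : map_mx _ _ = const_mx 1) ?diag_const_mx ?mulmx1 ?U1.1 //.
    by apply/matrixP => i j; rewrite !mxE expr0.
  rewrite exprS IH -[_ * _]/(_ *m _) !mulmxA -(mulmxA _ U) U1.2 mulmx1 -(mulmxA U^T) mulmx_diag.
  by congr (_ *m diag_mx _ *m _); apply/matrixP => i j; rewrite !mxE exprS !ord1.
have serE m : series (fun k => (k`!%:R)^-1 *: (U^T *m diag_mx d *m U) ^+ k) m =
    U^T *m diag_mx (\row_i series (exp_coeff (d 0 i)) m) *m U.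
  rewrite /series /=.
  transitivity (\sum_(0 <= k < m) U^T *m diag_mx (\row_i exp_coeff (d 0 i) k) *m U).
    apply: eq_bigr => k _; rewrite powE scalemxAl scalemxAr -linearZ /=.
    congr (_ *m diag_mx _ *m _); apply/matrixP => i j.
    by rewrite !mxE exp_coeffE /= !ord1.
  rewrite -mulmx_suml -mulmx_sumr -linear_sum /=; congr (_ *m diag_mx _ *m _).
  by apply/matrixP => i j; rewrite !ord1 summxE !mxE; apply: eq_bigr => k _; rewrite mxE.
rewrite (_ : series _ = fun m => U^T *m diag_mx (\row_i series (exp_coeff (d 0 i)) m) *m U);
  last exact/funext.
apply: cvg_mulmx; last exact: cvg_cst.
apply: cvg_mulmx; first exact: cvg_cst.
apply/cvg_mxP => i j; rewrite !mxE; under eq_fun do rewrite !mxE.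
case: (i == j) => /=; last by rewrite mulr0n; under eq_fun do rewrite mulr0n; exact: cvg_cst.
by rewrite mulr1n; under eq_fun do rewrite mulr1n; exact: is_cvg_series_exp_coeff.
Qed.

Lemma frame_coords_framed U d b : framed U d b -> frame_coords U b = diag_mx d.
Proof. by move=> [U1 ->]; rewrite frame_coords_conj. Qed.

Lemma frame_coords_expmx U d b t : framed U d b ->
  frame_coords U (expmx (t *: b)) = diag_mx (\row_i expR (t * d 0 i)).
Proof.
move=> /(framedZ t)/expmx_framed/frame_coords_framed ->; congr diag_mx.
by apply/matrixP => i j; rewrite !mxE !ord1.
Qed.

Lemma expmx_sym (b : 'M[R]_n) : b^T = b -> (expmx b)^T = expmx b.
Proof.
by move=> /spectral_theorem[U [d [U1 bE]]]; apply: framed_sym (expmx_framed (conj U1 bE)).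
Qed.

Lemma expmx_conj (U b : 'M[R]_n) : orthogonalmx U -> b^T = b ->
  expmx (U *m b *m U^T) = U *m expmx b *m U^T.
Proof.
move=> oU /spectral_theorem[V [d [oV bE]]].
have f : framed (V *m U^T) d (U *m b *m U^T).
  split; first by apply: orthogonalmxM => //; exact: orthogonalmx_tr.
  by rewrite trmx_mul trmxK bE !mulmxA.
have [_ ->] := expmx_framed f.
have [_ ->] := expmx_framed (conj oV bE).
by rewrite trmx_mul trmxK !mulmxA.
Qed.
End Frames.

(** * The parabolic subgroups and the decomposition of the group by them *)

Section GroupBasics.
Variables (R : realType) (n : nat) (G : set 'M[R]_n).
Hypotheses (G_subgroup : subgroup_of_SL G) (G_closed : closed G)
  (G_polar : G = [set k *m expmx X | k in compactK G & X in sym_part G]).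
Implicit Types (b g k : 'M[R]_n).

Lemma group1 : G 1%:M. Proof. by case: G_subgroup. Qed.

Lemma groupM g h : G g -> G h -> G (g *m h).
Proof. by case: G_subgroup => _ + _ _; exact. Qed.

Lemma groupV g : G g -> G (invmx g).
Proof. by case: G_subgroup => _ _ + _; exact. Qed.

Lemma group_det g : G g -> \det g = 1.
Proof. by case: G_subgroup => _ _ _; exact. Qed.

Lemma group_unit g : G g -> g \in unitmx.
Proof. by move=> /group_det gd; rewrite unitmxE gd unitr1. Qed.

Lemma sym_part_framed b : sym_part G b -> exists U d, framed U d b.
Proof.
by move=> [_ [/spectral_theorem[U [d [oU bE]]] _]]; exists U, d; split.
Qed.

Lemma sym_part_exp b t : sym_part G b -> G (expmx (t *: b)).
Proof. by move=> [+ _]; exact. Qed.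

Lemma compactK_orthogonal k : compactK G k -> orthogonalmx k.
Proof. by move=> [_ [k1 _]]; exact: orthogonalmxP. Qed.

Lemma compactK_inv k : compactK G k -> invmx k = k^T.
Proof.
move=> Kk; have [k1 k2] := compactK_orthogonal Kk.
have ku := group_unit Kk.1.
by rewrite -[invmx k]mul1mx -k1 -mulmxA mulmxV // mulmx1.
Qed.

Lemma compactK_tr k : compactK G k -> compactK G k^T.
Proof.
move=> Kk; have [k1 k2] := compactK_orthogonal Kk.
split; first by rewrite -compactK_inv //; apply: groupV; case: Kk.
by split; [rewrite trmxK | rewrite det_tr group_det //; case: Kk].
Qed.

Lemma Ad_compactK k b : compactK G k -> Ad k b = k *m b *m k^T.
Proof. by move=> Kk; rewrite /Ad compactK_inv. Qed.

Lemma sym_part_Ad k b : compactK G k -> sym_part G b -> sym_part G (Ad k b).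
Proof.
move=> Kk pb; have ok := compactK_orthogonal Kk; have [bs [bT tb]] := pb.
rewrite Ad_compactK //; split; last first.
  split; first by rewrite !trmx_mul trmxK bT mulmxA.
  by rewrite mxtrace_mulC mulmxA ok.1 mul1mx.
move=> t; rewrite scalemxAl scalemxAr expmx_conj //; last by rewrite linearZ /= bT.
apply: groupM; last by case: (compactK_tr Kk).
by apply: groupM; [case: Kk | exact: bs].
Qed.

(** Conjugation by [exp (t b)] multiplies the [(i, j)] entry in an eigenframe by
    [exp (t (d_i - d_j))]; as [t] tends to minus infinity it is bounded only
    if the entries with [d_i < d_j] vanish. *)
Lemma GplusP U d b g : framed U d b ->
  Gplus G b g <->
  G g /\ forall i j, d 0 i < d 0 j -> frame_coords U g i j = 0.
Proof.
move=> fb; have [oU _] := fb.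
have coordE t i j : frame_coords U (expmx (t *: b) *m g *m expmx (- t *: b)) i j =
    expR (t * (d 0 i - d 0 j)) * frame_coords U g i j.
  rewrite !frame_coordsM // !(frame_coords_expmx _ fb) mul_diag_mx mul_mx_diag !mxE.
  by rewrite mulrAC -expRD; congr (expR _ * _); ring.
split=> [[Gg /cvg_ex[L gL]]|[Gg gu]]; split=> //.
  move=> i j dij; pose f t := expR (t * (d 0 i - d 0 j)) * frame_coords U g i j.
  have fL : f @ -oo --> frame_coords U L i j.
    have /cvg_mxP/(_ i j) : (fun t : R => frame_coords U
        (expmx (t *: b) *m g *m expmx (- t *: b))) @ -oo --> frame_coords U L.
      exact: cvg_frame_coords.
    by rewrite (_ : (fun x => _) = f) //; apply/funext => t; rewrite coordE.
  have dij0 : 0 < d 0 j - d 0 i by rewrite subr_gt0.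
  have : (fun t => expR (t * (d 0 j - d 0 i)) * f t) @ -oo --> 0 * frame_coords U L i j.
    by apply: cvgM => //; exact: cvg_expR_linear_Ny.
  rewrite mul0r (_ : (fun t => _) = fun=> frame_coords U g i j); last first.
    by apply/funext => t; rewrite /f mulrA -expRD -mulrDr addrA subrK subrr mulr0 expR0 mul1r.
  exact: cvg_cst_eq.
pose L := U^T *m \matrix_(i, j) (if d 0 i == d 0 j then frame_coords U g i j else 0) *m U.
apply/cvg_ex; exists L.
suff : (fun t : R => frame_coords U (expmx (t *: b) *m g *m expmx (- t *: b))) @ -oo
    --> frame_coords U L.
  move=> h; rewrite -(frame_coordsK L oU).
  rewrite (_ : (fun t => _) = fun t => U^T *m
    frame_coords U (expmx (t *: b) *m g *m expmx (- t *: b)) *m U); last first.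
    by apply/funext => t; rewrite frame_coordsK.
  apply: cvg_mulmx; last exact: cvg_cst.
  by apply: cvg_mulmx => //; exact: cvg_cst.
apply/cvg_mxP => i j; rewrite (_ : (fun t : R => _) =
    (fun t => expR (t * (d 0 i - d 0 j)) * frame_coords U g i j)); last first.
  by apply/funext => t; rewrite coordE.
rewrite /L frame_coords_conj // [X in _ --> X]mxE.
have [dij|dij] := eqVneq (d 0 i) (d 0 j).
  rewrite dij subrr (_ : (fun t => _) = fun=> frame_coords U g i j); first exact: cvg_cst.
  by apply/funext => t; rewrite mulr0 expR0 mul1r.
have [dlt|dgt|/eqP] := ltgtP (d 0 i) (d 0 j); last by rewrite (negbTE dij).
  rewrite gu // (_ : (fun t => _) = fun=> 0); first exact: cvg_cst.
  by apply/funext => t; rewrite mulr0.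
rewrite -[X in _ --> X](mul0r (frame_coords U g i j)).
by apply: cvgM; [apply: cvg_expR_linear_Ny; rewrite subr_gt0 | exact: cvg_cst].
Qed.

Lemma cvg_ultra_orthogonal (F : set_system nat) (FF : UltraFilter F)
    (k : nat -> 'M[R]_n) :
  (forall m, orthogonalmx (k m)) -> exists2 k0, k @ F --> k0 & orthogonalmx k0.
Proof.
move=> ok.
have kb i j m : `|k m i j| <= 1 by exact: orthogonal_le1.
have /choice[l kl] : forall ij : 'I_n * 'I_n, exists l : R, (fun m => k m ij.1 ij.2) @ F --> l.
  by move=> ij; exact: cvg_ultra_bounded (kb _ _).
pose k0 := \matrix_(i, j) l (i, j).
have kk0 : k @ F --> k0 by apply/cvg_mxP => i j; rewrite mxE; exact: kl (i, j).
exists k0 => //; apply: orthogonalmxP.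
apply/esym/(@cvg_cst_eq _ _ _ F).
rewrite (_ : (fun _ => _) = fun m => (k m)^T *m k m); last by apply/funext => m; rewrite (ok m).1.
by apply: cvg_mulmx => //; exact: cvg_trmx.
Qed.

Lemma cvg_ultra_compactK (F : set_system nat) (FF : UltraFilter F)
    (k : nat -> 'M[R]_n) :
  (forall m, compactK G (k m)) -> exists2 k0, k @ F --> k0 & compactK G k0.
Proof.
move=> Kk; have [|k0 kk0 ok0] := @cvg_ultra_orthogonal F FF k.
  by move=> m; exact: compactK_orthogonal.
exists k0 => //.
have Gk0 : G k0.
  by apply: (closed_cvg G G_closed _ _ kk0); apply: nearW => m; case: (Kk m).
by split=> //; split; [exact: ok0.1 | exact: group_det].
Qed.

Lemma polar g : G g -> exists k X, [/\ compactK G k, sym_part G X & g = k *m expmx X].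
Proof. by rewrite {1}G_polar => -[k Kk [X pX <-]]; exists k, X. Qed.

(** Writing [g exp (m b) = k_m P_m] with [P_m] symmetric, the matrix
    [h_m = k_m^-1 g] satisfies [exp (- m b) h_m exp (m b) = h_m^T]. Hence, in an
    eigenframe, the entries of [h_m] with [d_i < d_j] tend to zero, and a cluster
    point [k] of the [k_m] gives [k^-1 g] in [G^{b+}]. *)
Theorem iwasawa b g : sym_part G b -> G g ->
  exists k q, [/\ compactK G k, Gplus G b q & g = k *m q].
Proof.
move=> pb Gg; have [U [d fb]] := sym_part_framed pb; have [oU _] := fb.
have /choice[k Hk] : forall m : nat, exists k, compactK G k /\
    exists2 X, sym_part G X & g *m expmx (m%:R *: b) = k *m expmx X.
  move=> m; have /polar[k [X [Kk pX E]]] := groupM Gg (sym_part_exp m%:R pb).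
  by exists k; split => //; exists X.
have [F [FF ooF]] := ultra_nat.
have [k0 kk0 Kk0] := @cvg_ultra_compactK F FF k (fun m => (Hk m).1).
have [ok1 ok2] := compactK_orthogonal Kk0.
exists k0, (k0^T *m g); split=> //; last by rewrite mulmxA ok2 mul1mx.
apply/(GplusP _ fb); split; first by apply: groupM => //; case: (compactK_tr Kk0).
move=> i j dij.
pose h m := frame_coords U ((k m)^T *m g).
have hE m : h m i j = expR (m%:R * (d 0 i - d 0 j)) * h m j i.
  have [Kkm [X [_ [XT _]] E]] := Hk m.
  have [okm _] := compactK_orthogonal Kkm.
  have S : ((k m)^T *m g *m expmx (m%:R *: b))^T = (k m)^T *m g *m expmx (m%:R *: b).
    by rewrite -mulmxA E mulmxA okm mul1mx expmx_sym.
  have /matrixP/(_ j i) : frame_coords U ((k m)^T *m g *m expmx (m%:R *: b))^T =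
    h m *m diag_mx (\row_i expR (m%:R * d 0 i)).
    by rewrite S frame_coordsM // (frame_coords_expmx _ fb).
  rewrite -frame_coordsT frame_coordsM // (frame_coords_expmx _ fb) -/(h m).
  rewrite mul_mx_diag !mxE => hij; apply: (mulIf (lt0r_neq0 (expR_gt0 (m%:R * d 0 j)))).
  rewrite hij mulrAC -expRD mulrC; congr (expR _ * _); ring.
have hc i' j' : (fun m => h m i' j') @ F --> frame_coords U (k0^T *m g) i' j'.
  move: i' j'; apply/cvg_mxP; apply: cvg_frame_coords.
  by apply: cvg_mulmx; [exact: cvg_trmx | exact: cvg_cst].
have dij0 : d 0 i - d 0 j < 0 by rewrite subr_lt0.
rewrite -[RHS](mul0r (frame_coords U (k0^T *m g) j i)).
apply: (normed_cvg_unique (hc i j)).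
rewrite (_ : (fun m => _) = fun m =>
  expR (m%:R * (d 0 i - d 0 j)) * h m j i); last by apply/funext => m; rewrite hE.
by apply: cvgM => //; exact: cvg_expR_nat.
Qed.

(** A block triangular orthogonal matrix is block diagonal: its rows and columns
    being unit vectors, [\sum_(i, j) k_ij ^ 2 (d_i - d_j) = 0], while every term
    is nonnegative. *)
Lemma compactK_Gplus_commute k b : sym_part G b -> compactK G k -> Gplus G b k ->
  Ad k b = b.
Proof.
move=> pb Kk; have [U [d fb]] := sym_part_framed pb; have [oU bE] := fb.
move=> /(GplusP _ fb)[_ ku].
have ok := compactK_orthogonal Kk.
have oh : orthogonalmx (frame_coords U k).
  by rewrite /frame_coords; apply: orthogonalmxM; [exact: orthogonalmxM | exact: orthogonalmx_tr].
set h := frame_coords U k in ku oh.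
have rowh i : \sum_j h i j ^+ 2 = 1 by exact: orthogonal_row.
have colh j : \sum_i h i j ^+ 2 = 1 by exact: orthogonal_col.
have term_ge0 i j : 0 <= h i j ^+ 2 * (d 0 i - d 0 j).
  have [/ku ->|dji] := ltP (d 0 i) (d 0 j); first by rewrite expr0n mul0r.
  by rewrite mulr_ge0 ?sqr_ge0 // subr_ge0.
have sum0 : \sum_i \sum_j h i j ^+ 2 * (d 0 i - d 0 j) = 0.
  under eq_bigr do under eq_bigr do rewrite mulrBr.
  under eq_bigr do rewrite sumrB -mulr_suml rowh mul1r.
  rewrite sumrB exchange_big /=; apply/eqP; rewrite subr_eq0; apply/eqP.
  by apply: eq_bigr => j _; rewrite -mulr_suml colh mul1r.
have term0 i j : h i j ^+ 2 * (d 0 i - d 0 j) = 0.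
  move: sum0 => /eqP; rewrite psumr_eq0; last by move=> i' _; exact: sumr_ge0.
  move=> /allP/(_ i (mem_index_enum _)) /=; rewrite psumr_eq0 //.
  by move=> /allP/(_ j (mem_index_enum _))/eqP.
have hb : k *m b = b *m k.
  rewrite -(frame_coordsK (k *m b) oU) -(frame_coordsK (b *m k) oU).
  rewrite !frame_coordsM // (frame_coords_framed fb); congr (_ *m _ *m _).
  apply/matrixP => i j; rewrite mul_mx_diag mul_diag_mx [LHS]mxE [RHS]mxE mulrC.
  apply/eqP; rewrite -subr_eq0 -mulrBl; apply/eqP.
  have /eqP := term0 i j; rewrite mulf_eq0 sqrf_eq0 => /orP[/eqP ->|]; first by rewrite mulr0.
  by rewrite -opprB oppr_eq0 => /eqP ->; rewrite mul0r.
by rewrite Ad_compactK // hb -mulmxA ok.2 mulmx1.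
Qed.

End GroupBasics.

(** * Subspaces generated near the identity *)

Section VspaceMatrix.
Variables (K : fieldType) (n : nat).
Implicit Types (V W : {vspace 'cV[K]_n}) (A g : 'M[K]_n).

Lemma linfun_mulmxE A v : linfun (mulmx A : 'cV[K]_n -> 'cV[K]_n) v = A *m v.
Proof. by rewrite lfunE. Qed.

Definition kernel_mx A : {vspace 'cV[K]_n} := lker (linfun (mulmx A : 'cV[K]_n -> 'cV[K]_n)).

Lemma mem_kernel_mx A v : (v \in kernel_mx A) = (A *m v == 0).
Proof. by rewrite memv_ker linfun_mulmxE. Qed.

Lemma lfun_mxE (f : 'End('cV[K]_n)) : exists A, forall v, f v = A *m v.
Proof.
exists (\matrix_(i, j) f (delta_mx j 0) i 0) => v.
have vE : v = \sum_j v j 0 *: delta_mx j 0.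
  rewrite {1}[v]matrix_sum_delta; apply: eq_bigr => j _; exact: big_ord1.
rewrite {1}vE linear_sum; apply/matrixP => i j; rewrite ord1 summxE mxE.
by apply: eq_bigr => k _; rewrite linearZ !mxE mulrC.
Qed.

(** A subspace is thus given by linear equations, which pass to limits. *)
Lemma vspace_kernel_mx W : exists A, W = kernel_mx A.
Proof.
have [A AE] := lfun_mxE (projv W); exists (1%:M - A); apply/vspaceP => v.
rewrite mem_kernel_mx mulmxBl mul1mx -AE subr_eq0; apply/idP/eqP => [/projv_id ->//|->].
exact: memv_proj.
Qed.

Lemma act_vspace_subP g V W :
  reflect (forall v, v \in V -> g *m v \in W) (act_vspace g V <= W)%VS.
Proof.
apply: (iffP subvP) => [gV v vV|gV _ /memv_imgP[v vV ->]].
  by apply: gV; rewrite -linfun_mulmxE; exact: memv_img.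
by rewrite linfun_mulmxE; exact: gV.
Qed.

Lemma act_vspace_eq g W : g \in unitmx ->
  (forall v, v \in W -> g *m v \in W) -> act_vspace g W = W.
Proof.
move=> gu /act_vspace_subP gW; apply/eqP; rewrite eqEdim gW /= limg_dim_eq //.
apply/eqP; rewrite -subv0; apply/subvP => v; rewrite memv_cap memv_ker linfun_mulmxE memv0.
by move=> /andP[_ /eqP gv]; rewrite -(mulKmx gu v) gv mulmx0.
Qed.

Lemma mem_act_vspaceV g W v : g \in unitmx ->
  act_vspace g W = W -> v \in W -> invmx g *m v \in W.
Proof.
by move=> gu {1}<- /memv_imgP[u uW ->]; rewrite linfun_mulmxE mulKmx.
Qed.

(** Subspaces satisfying a property that is stable under intersection have a
    least element, of minimal dimension. *)
Lemma least_vspace (P : {vspace 'cV[K]_n} -> Prop) : P fullv ->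
  (forall V W, P V -> P W -> P (V :&: W)%VS) ->
  exists2 V, P V & forall W, P W -> (V <= W)%VS.
Proof.
move=> Pf Pcap.
have ex : exists d, `[< exists2 V, P V & \dim V = d >].
  by exists (\dim {: 'cV[K]_n}); apply/asboolP; exists fullv.
have [d /asboolP[V PV dV] dmin] := ex_minnP ex.
exists V => // W PW; have PVW := Pcap _ _ PV PW.
have dVW : (\dim V <= \dim (V :&: W))%N.
  by rewrite dV; apply: dmin; apply/asboolP; exists (V :&: W)%VS.
have /eqP <- : (V :&: W)%VS == V by rewrite eqEdim capvSl.
exact: capvSr.
Qed.

Lemma act_vspaceV_stable g V : g \in unitmx -> (V <= act_vspace (invmx g) V)%VS ->
  forall v, v \in V -> g *m v \in V.
Proof.
by move=> gu /subvP gV v /gV/memv_imgP[u uV ->]; rewrite linfun_mulmxE mulKVmx.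
Qed.

Lemma mem_act_vspace_invmx g V v : g \in unitmx -> g *m v \in V -> v \in act_vspace (invmx g) V.
Proof.
by move=> gu gv; apply/memv_imgP; exists (g *m v); rewrite ?linfun_mulmxE ?mulKmx.
Qed.

End VspaceMatrix.

Section NearIdentity.
Variables (R : realType) (n : nat) (G : set 'M[R]_n).
Hypotheses (G_subgroup : subgroup_of_SL G) (G_connected : connected G)
  (G_irr : irreducible_on G fullv).

Lemma continuous_mulmxlr m p q r (A : 'M[R]_(m, p)) (B : 'M[R]_(q, r)) :
  continuous (fun x : 'M[R]_(p, q) => A *m x *m B).
Proof.
move=> x; apply: (@cvg_mulmx R _ (nbhs x) _ m q r (fun y => A *m y) (fun=> B)).
  apply: (@cvg_mulmx R _ (nbhs x) _ m p q (fun=> A) (fun y => y)); first exact: cvg_cst.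
  exact: cvg_id.
exact: cvg_cst.
Qed.

Lemma closed_stabilizer_cond (A : 'M[R]_n) (B : {vspace 'cV[R]_n}) :
  closed [set x : 'M[R]_n | forall v, v \in B -> A *m x *m v = 0].
Proof.
rewrite (_ : mkset _ = \bigcap_(v in [set v | v \in B])
    ((fun x : 'M[R]_n => A *m x *m v) @^-1` [set 0])); last first.
  by apply/seteqP; split=> x /= h v; exact: h.
apply: closed_bigI => v _; apply: preimage_closed.
  by move=> x _; exact: continuous_mulmxlr.
by apply: accessible_closed_set1; apply: hausdorff_accessible; exact: norm_hausdorff.
Qed.

(** Among the subspaces that contain [g w] for all [w] in [W] and all [g] in
    some neighbourhood of the identity of [G], the least one is stable under a
    neighbourhood of the identity, hence under the connected group [G]. *)
Theorem near_identity_spanning (W A : {vspace 'cV[R]_n}) : W <> 0%VS ->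
  (\forall g \near (1%:M : 'M[R]_n), G g -> forall w, w \in W -> g *m w \in A) ->
  A = fullv.
Proof.
move=> W0 nearA.
pose P (B : {vspace 'cV[R]_n}) :=
  \forall g \near (1%:M : 'M[R]_n), G g -> forall w, w \in W -> g *m w \in B.
have [||B PB Bmin] := @least_vspace R n P.
- by apply: (@nearW _ (nbhs (1%:M : 'M[R]_n))) => g _ w _; exact: memvf.
- move=> V V' PV PV'; rewrite /P; apply: filterS2 PV PV' => g gV gV' Gg w wW.
  by rewrite memv_cap gV // gV'.
have BA : (B <= A)%VS by exact: Bmin.
pose N := [set g | G g -> forall w, w \in W -> g *m w \in B]°.
have N1 : N 1%:M by exact: PB.
have NP g : N g -> G g -> forall w, w \in W -> g *m w \in B by move=> /interior_subset.
pose H := [set g | G g /\ forall v, v \in B -> g *m v \in B].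
have NH g : G g -> N g -> H g.
  move=> Gg Ng; split=> // v vB; have gu := group_unit G_subgroup Gg.
  apply: (act_vspaceV_stable gu) vB; apply: Bmin; rewrite /P.
  have gN : \forall h \near (1%:M : 'M[R]_n), N (g *m h).
    have nN : nbhs (g *m 1%:M *m 1%:M) N.
      by rewrite !mulmx1; apply: open_nbhs_nbhs; split => //; exact: open_interior.
    have := @continuous_mulmxlr n n n n g 1%:M 1%:M N nN.
    by apply: (@filterS _ (nbhs (1%:M : 'M[R]_n))) => h /=; rewrite mulmx1.
  apply: (@filterS _ (nbhs (1%:M : 'M[R]_n)) _ _ _ _ gN) => h /NP hB Gh w wW.
  apply: mem_act_vspace_invmx => //.
  by rewrite mulmxA; apply: hB => //; exact: groupM.
have HM g h : H g -> H h -> H (g *m h).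
  move=> [Gg gB] [Gh hB]; split; first exact: groupM.
  by move=> v vB; rewrite -mulmxA; apply: gB; exact: hB.
have HG : H = G.
  apply: G_connected.
  - by exists 1%:M; split; [exact: group1 | move=> v; rewrite mul1mx].
  - exists (\bigcup_(h in H) ((fun x => invmx h *m x *m 1%:M) @^-1` N)).
      apply: bigcup_open => h _; apply: open_comp; last exact: open_interior.
      by move=> x _; exact: continuous_mulmxlr.
    apply/seteqP; split=> x.
      move=> Hx; have [Gx _] := Hx; split=> //; exists x => //=.
      by rewrite mulVmx ?mulmx1 //; exact: group_unit Gx.
    move=> [Gx [h Hh /=]]; rewrite mulmx1 => hxN.
    have [Gh _] := Hh; have hu := group_unit G_subgroup Gh.
    rewrite -(mulKVmx hu x); apply: HM => //; apply: NH => //.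
    by apply: groupM => //; exact: groupV.
  - have [C CB] := vspace_kernel_mx B.
    exists [set x : 'M[R]_n | forall v, v \in B -> C *m x *m v = 0].
      exact: closed_stabilizer_cond.
    apply/seteqP; split=> x [Gx xB]; split=> // v vB.
      by have := xB _ vB; rewrite CB mem_kernel_mx mulmxA => /eqP.
    by rewrite CB mem_kernel_mx mulmxA xB.
have GB g : G g -> (act_vspace g B <= B)%VS.
  by rewrite -HG => -[_ gB]; apply/act_vspace_subP.
have [B0|BT] := G_irr.2 B (subvf _) GB.
  case: W0; apply/eqP; rewrite -subv0 -B0; apply/subvP => w wW.
  by have := NP _ N1 (group1 G_subgroup) w wW; rewrite mul1mx.
by apply/eqP; rewrite eqEsubv subvf -BT.
Qed.
End NearIdentity.

(** * Admissible subspaces are leading eigenspaces *)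

Section Admissible.
Variables (R : realType) (n : nat) (G : set 'M[R]_n).
Hypotheses (G_subgroup : subgroup_of_SL G) (G_closed : closed G) (G_connected : connected G)
  (G_polar : G = [set k *m expmx X | k in compactK G & X in sym_part G])
  (G_irr : irreducible_on G fullv).
Variables (b U : 'M[R]_n) (d : 'rV[R]_n) (W : {vspace 'cV[R]_n}).
Hypotheses (pb : sym_part G b) (fb : framed U d b)
  (stabE : stabilizer G W = Gplus G b) (W_irr : irreducible_on (stabilizer G W) W).

Let oU : orthogonalmx U := fb.1.

Definition spectral_proj (P : pred R) : 'M[R]_n :=
  U^T *m diag_mx (\row_i (P (d 0 i))%:R) *m U.

Lemma spectral_proj_coord P (v : 'cV[R]_n) i :
  (U *m (spectral_proj P *m v)) i 0 = (P (d 0 i))%:R * (U *m v) i 0.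
Proof.
by rewrite /spectral_proj !mulmxA oU.2 mul1mx -mulmxA mul_diag_mx mxE [X in X * _]mxE.
Qed.

Lemma frame_inj (v w : 'cV[R]_n) : (forall i, (U *m v) i 0 = (U *m w) i 0) -> v = w.
Proof.
move=> vw; rewrite -[v]mul1mx -[w]mul1mx -oU.1 -!mulmxA; congr (_ *m _).
by apply/matrixP => i j; rewrite ord1.
Qed.

Lemma mul_coord g (v : 'cV[R]_n) i :
  (U *m (g *m v)) i 0 = \sum_j frame_coords U g i j * (U *m v) j 0.
Proof.
rewrite (_ : U *m (g *m v) = frame_coords U g *m (U *m v)); last first.
  by rewrite /frame_coords !mulmxA -(mulmxA _ U^T) oU.1 mulmx1.
by rewrite mxE.
Qed.

Lemma expmx_coord t (v : 'cV[R]_n) i :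
  (U *m (expmx (t *: b) *m v)) i 0 = expR (t * d 0 i) * (U *m v) i 0.
Proof.
rewrite (_ : U *m (_ *m v) = frame_coords U (expmx (t *: b)) *m (U *m v)); last first.
  by rewrite /frame_coords !mulmxA -(mulmxA _ U^T) oU.1 mulmx1.
by rewrite (frame_coords_expmx _ fb) mul_diag_mx mxE [X in X * _]mxE.
Qed.

Lemma Gplus_stab g w : Gplus G b g -> w \in W -> g *m w \in W.
Proof.
rewrite -stabE => -[_ gW] wW; rewrite -gW -linfun_mulmxE; exact: memv_img.
Qed.

Lemma GplusV g : Gplus G b g -> Gplus G b (invmx g).
Proof.
rewrite -stabE => -[Gg gW]; split; first exact: groupV.
apply: act_vspace_eq; first by rewrite unitmx_inv; exact: group_unit Gg.
by move=> v; apply: mem_act_vspaceV => //; exact: group_unit Gg.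
Qed.

Lemma Gplus_exp t : Gplus G b (expmx (t *: b)).
Proof.
apply/(GplusP G _ fb); split; first exact: sym_part_exp.
move=> i j dij; rewrite (frame_coords_expmx _ fb) mxE.
by case: eqVneq dij => [->|]; rewrite ?ltxx.
Qed.

Definition single_eigenvalue l := (exists i, d 0 i = l) /\
  forall w, w \in W -> forall i, d 0 i != l -> (U *m w) i 0 = 0.

(** For the least eigenvalue [l] occurring in [W], the part of [W] in the
    eigenspaces above [l] is stable under [G^{b+}], hence zero; it contains
    [exp b w - exp l w] for every [w] in [W]. *)
Lemma admissible_single_eigenvalue : exists l, single_eigenvalue l.
Proof.
have [W0 W_min] := W_irr.
pose occ i := `[< exists2 w, w \in W & (U *m w) i 0 != 0 >].
have [i1 occ1] : exists i, occ i.
  apply: contrapT => nocc; case: W0; apply/eqP; rewrite -subv0; apply/subvP => w wW.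
  rewrite memv0; apply/eqP/frame_inj => i; rewrite mulmx0 [RHS]mxE.
  by apply: contrapT => /eqP wi; apply: nocc; exists i; apply/asboolP; exists w.
case: (@arg_minP _ R 'I_n i1 occ (fun i => d 0 i) occ1) => i0 /asboolP[w0 w0W w0i] imin.
exists (d 0 i0); split; first by exists i0.
have low w i : w \in W -> d 0 i < d 0 i0 -> (U *m w) i 0 = 0.
  move=> wW dlt; apply/eqP; apply: contraTT dlt => wi; rewrite -leNgt.
  by apply: imin; apply/asboolP; exists w.
pose Z := spectral_proj (fun x => x <= d 0 i0).
have ZP v : reflect (forall i, d 0 i <= d 0 i0 -> (U *m v) i 0 = 0) (v \in kernel_mx Z).
  rewrite mem_kernel_mx; apply: (iffP eqP) => [Zv i di|vi].
    have := spectral_proj_coord (fun x => x <= d 0 i0) v i.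
    by rewrite -/Z Zv mulmx0 [LHS]mxE di mul1r => <-.
  apply: frame_inj => i; rewrite spectral_proj_coord mulmx0 [RHS]mxE.
  by case: leP => [/vi ->|]; rewrite ?mulr0 ?mul0r.
have [|g Qg|W10|W1W] := W_min (W :&: kernel_mx Z)%VS; first exact: capvSl.
- apply/act_vspace_subP => v; rewrite !memv_cap => /andP[vW /ZP vZ].
  rewrite (Gplus_stab _ vW) /= -?stabE //; apply/ZP => i di; rewrite mul_coord.
  have [_ gu] : G g /\ forall i j, d 0 i < d 0 j -> frame_coords U g i j = 0.
    by apply/(GplusP G _ fb); rewrite -stabE.
  rewrite big1 // => j _; have [/vZ ->|dj] := leP (d 0 j) (d 0 i0); first by rewrite mulr0.
  by rewrite gu ?mul0r // (le_lt_trans di).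
- move=> w wW i di.
  (* The component of [y] in the lowest eigenspace vanishes. *)
  pose y := expmx (1 *: b) *m w - expR (d 0 i0) *: w.
  have yi j : (U *m y) j 0 = (expR (d 0 j) - expR (d 0 i0)) * (U *m w) j 0.
    rewrite /y mulmxBr -scalemxAr mxE expmx_coord mul1r mulrBl; congr (_ + _).
    by rewrite mxE [X in - X]mxE.
  have : y \in (W :&: kernel_mx Z)%VS.
    rewrite memv_cap rpredB ?rpredZ ?(Gplus_stab _ wW) //=; last exact: Gplus_exp.
    apply/ZP => j; rewrite le_eqVlt yi => /orP[/eqP ->|dj]; first by rewrite subrr mul0r.
    by rewrite low // mulr0.
  rewrite W10 memv0 => /eqP y0; have := yi i; rewrite y0 mulmx0 [LHS]mxE => /esym/eqP.
  rewrite mulf_eq0 subr_eq0 => /orP[/eqP/expR_inj/eqP|/eqP //].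
  by rewrite (negbTE di).
- move: w0W; rewrite -W1W memv_cap => /andP[_ /ZP/(_ i0 (lexx _))/eqP].
  by rewrite (negbTE w0i).
Qed.

Section FlowLimit.
Variables (F : set_system nat) (FF : UltraFilter F) (ooF : \oo `<=` F).
Variable g : 'M[R]_n.
Hypothesis (Gg : G g).
Hypothesis g_near : forall i j, `|frame_coords U g i j - (i == j)%:R| <= (n%:R * 2)^-1.
Variables (k q : nat -> 'M[R]_n) (k0 : 'M[R]_n).
Hypothesis kq : forall m, [/\ compactK G (k m), Gplus G b (q m)
  & expmx (m%:R *: b) *m g = k m *m q m].
Hypothesis kk0 : k @ F --> k0.

(** The bound on the entries makes [g - 1] contract the sup norm by one half. *)
Lemma near_identity_row (u : 'I_n -> R) M i : (forall l, `|u l| <= M) ->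
  `|\sum_l frame_coords U g i l * u l - u i| <= M / 2.
Proof.
move=> uM; have M0 : 0 <= M by exact: le_trans (uM i).
have -> : \sum_l frame_coords U g i l * u l - u i =
    \sum_l (frame_coords U g i l - (i == l)%:R) * u l.
  under [RHS]eq_bigr do rewrite mulrBl.
  rewrite sumrB; congr (_ - _); rewrite (bigD1 i) //= eqxx mul1r big1 ?addr0 // => l li.
  by rewrite eq_sym (negbTE li) mul0r.
have n0 : (n%:R : R) != 0 by rewrite pnatr_eq0 -lt0n (leq_trans _ (ltn_ord i)).
apply: le_trans (ler_norm_sum _ _ _) _.
apply: (@le_trans _ _ (\sum_(l < n) (n%:R * 2)^-1 * M)).
  by apply: ler_sum => l _; rewrite normrM ler_pM.
rewrite sumr_const card_ord -mulr_natl le_eqVlt; apply/orP; left; apply/eqP.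
by field.
Qed.

(** The column [u] of [q_m^-1] is supported on the indices [l] with [d_l >= d_j]. At
    its largest entry, the orthogonal matrix [k_m = exp (m b) g q_m^-1] has an entry
    at least [exp (m d_j) |u| / 2], which is at most one. Hence [|u| <= 2 exp (- m d_j)],
    and [g u] is at most twice as large as [u]. *)
Lemma flow_limit_entry m i j :
  `|frame_coords U (k m) i j| <= 4 * expR (m%:R * (d 0 i - d 0 j)).
Proof.
have [Kk Qq E] := kq m; have Qu := group_unit G_subgroup Qq.1.
have [_ qu] : G (invmx (q m)) /\
    forall i j, d 0 i < d 0 j -> frame_coords U (invmx (q m)) i j = 0.
  by apply/(GplusP G _ fb); exact: GplusV.
pose u l := frame_coords U (invmx (q m)) l j.
have kE l : frame_coords U (k m) l j =
    expR (m%:R * d 0 l) * \sum_l' frame_coords U g l l' * u l'.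
  have -> : k m = expmx (m%:R *: b) *m (g *m invmx (q m)) by rewrite mulmxA E mulmxK.
  rewrite frame_coordsM // (frame_coords_expmx _ fb) mul_diag_mx mxE [X in X * _]mxE.
  by rewrite frame_coordsM // [X in _ * X]mxE.
case: (@arg_maxP _ R 'I_n j xpredT (fun l => `|u l|) isT) => l0 _ lmax.
have {}lmax l : `|u l| <= `|u l0| by exact: lmax.
have u0 : 0 <= `|u l0| by [].
have bound : `|u l0| <= 2 * expR (- (m%:R * d 0 j)).
  have [ul0|ul0] := eqVneq (u l0) 0; first by rewrite ul0 normr0 mulr_ge0 ?expR_ge0.
  have dl0 : d 0 j <= d 0 l0 by rewrite leNgt; apply: contraNN ul0 => /qu; rewrite /u => ->.
  have := near_identity_row l0 lmax; set S := \sum_l _ => Sl.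
  have Slow : `|u l0| / 2 <= `|S|.
    by have := ler_distD S 0 (u l0); rewrite !sub0r !normrN; lra.
  have : `|frame_coords U (k m) l0 j| <= 1.
    apply: orthogonal_le1; rewrite /frame_coords; apply: orthogonalmxM; last exact: orthogonalmx_tr.
    by apply: orthogonalmxM => //; exact: compactK_orthogonal Kk.
  rewrite kE -/S normrM (ger0_norm (expR_ge0 _)) => h1.
  have e1 : expR (m%:R * d 0 j) <= expR (m%:R * d 0 l0) by rewrite ler_expR ler_wpM2l.
  have e0 := expR_gt0 (m%:R * d 0 j).
  rewrite expRN ler_pdivlMr //.
  have : expR (m%:R * d 0 j) * (`|u l0| / 2) <= 1.
    apply: le_trans h1; apply: ler_pM => //; exact: expR_ge0.
  by nra.
have := near_identity_row i lmax; set S := \sum_l _ => Si.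
have Sup : `|S| <= 2 * `|u l0|.
  have := lmax i; have := ler_normD (S - u i) (u i); rewrite subrK; lra.
rewrite kE -/S normrM (ger0_norm (expR_ge0 _)) mulrBr expRD.
have e0 := expR_gt0 (m%:R * d 0 i).
have : `|S| <= 4 * expR (- (m%:R * d 0 j)) by lra.
by nra.
Qed.

Lemma flow_limit_Gplus : compactK G k0 -> Gplus G b k0.
Proof.
move=> Kk0; apply/(GplusP G _ fb); split; first by case: Kk0.
move=> i j dij; pose c m := frame_coords U (k m) i j * expR (- (m%:R * (d 0 i - d 0 j))).
have [m|c0 cc0] := @cvg_ultra_bounded R F FF c 4.
  rewrite /c normrM (ger0_norm (expR_ge0 _)) expRN ler_pdivrMr ?expR_gt0 //.
  exact: flow_limit_entry.
have dij0 : d 0 i - d 0 j < 0 by rewrite subr_lt0.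
have /cvg_mxP/(_ i j) kc : (fun m => frame_coords U (k m)) @ F --> frame_coords U k0.
  exact: cvg_frame_coords.
apply: (normed_cvg_unique kc); rewrite -(mulr0 c0) (_ : (fun m => _) = fun m =>
  c m * expR (m%:R * (d 0 i - d 0 j))); last first.
  by apply/funext => m; rewrite /c -mulrA -expRD addNr expR0 mulr1.
by apply: cvgM => //; exact: cvg_expR_nat.
Qed.

End FlowLimit.

(** Under the flow of [exp (m b)] the point [g W] of the Grassmannian accumulates
    at [W], because [g] is close to the identity; so the leading component of [g w],
    if it lies in [V_l] or above, is in [W]. *)
Lemma near_identity_leading_part l g w : single_eigenvalue l -> G g ->
  (forall i j, `|frame_coords U g i j - (i == j)%:R| <= (n%:R * 2)^-1) ->
  w \in W -> spectral_proj (fun x => l <= x) *m (g *m w) \in W.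
Proof.
move=> [_ Wl] Gg g_near wW.
set x := g *m w; set y := spectral_proj _ *m x.
pose occ i := (l <= d 0 i) && ((U *m x) i 0 != 0).
have [[i1 occ1]|nocc] := pselect (exists i, occ i); last first.
  suff -> : y = 0 by exact: mem0v.
  apply: frame_inj => i; rewrite spectral_proj_coord mulmx0 [RHS]mxE.
  case: leP => di; last by rewrite mul0r.
  rewrite mul1r; apply/eqP; apply: contrapT => /negP xi; apply: nocc.
  by exists i; rewrite /occ di.
have [F [FF ooF]] := ultra_nat.
have /choice[kq kqE] : forall m : nat, exists kq : 'M[R]_n * 'M[R]_n,
    [/\ compactK G kq.1, Gplus G b kq.2 & expmx (m%:R *: b) *m g = kq.1 *m kq.2].
  move=> m; have Gm : G (expmx (m%:R *: b) *m g) by apply: groupM => //; exact: sym_part_exp.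
  by have [k [q ?]] := iwasawa G_subgroup G_closed G_polar pb Gm; exists (k, q).
have Kkq m : compactK G (kq m).1 by case: (kqE m).
have [k0 kk0 Kk0] := cvg_ultra_compactK G_subgroup G_closed FF Kkq.
have Qk0 : Gplus G b k0.
  by apply: (flow_limit_Gplus FF ooF g_near (q := fun m => (kq m).2) _ kk0 Kk0).
case: (@arg_maxP _ R 'I_n i1 occ (fun i => d 0 i) occ1) => i0 /andP[di0 xi0] imax.
pose yl := spectral_proj (fun x => x == d 0 i0) *m x.
have high i : d 0 i0 < d 0 i -> (U *m x) i 0 = 0.
  move=> dlt; apply/eqP; apply: contraTT dlt => xi; rewrite -leNgt.
  have [di|di] := leP l (d 0 i); first by apply: imax; rewrite /occ di.
  exact: ltW (lt_le_trans di di0).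
pose ym m := expR (- (m%:R * d 0 i0)) *: (expmx (m%:R *: b) *m x).
have ymW m : ((kq m).1)^T *m ym m \in W.
  have [Kk Qq E] := kqE m; have [k1 _] := compactK_orthogonal Kk.
  rewrite /ym /x mulmxA E -scalemxAr rpredZ // !mulmxA k1 mul1mx.
  exact: Gplus_stab wW.
(* The terms of [x] above [d_i0] vanish, and those below it are damped. *)
have yml : ym @ F --> yl.
  rewrite (_ : ym = fun m => U^T *m (U *m ym m)); last first.
    by apply/funext => m; rewrite mulmxA oU.1 mul1mx.
  rewrite -[yl]mul1mx -oU.1 -mulmxA.
  apply: (@cvg_mulmx _ _ F _ _ _ _ (fun=> U^T)); first exact: cvg_cst.
  apply/cvg_mxP => i j; rewrite !ord1 spectral_proj_coord.
  rewrite (_ : (fun m => _) = fun m => expR (m%:R * (d 0 i - d 0 i0)) * (U *m x) i 0); last first.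
    apply/funext => m; rewrite /ym -scalemxAr [LHS]mxE expmx_coord mulrA -expRD mulrBr.
    by rewrite addrC.
  have [->|dne] := eqVneq (d 0 i) (d 0 i0).
    rewrite mul1r (_ : (fun m => _) = fun=> (U *m x) i 0); first exact: cvg_cst.
    by apply/funext => m; rewrite subrr mulr0 expR0 mul1r.
  have [dlt|/high ->|deq] := ltgtP (d 0 i) (d 0 i0); last by rewrite deq eqxx in dne.
    by apply: cvgM; [apply: cvg_expR_nat => //; rewrite subr_lt0 | exact: cvg_cst].
  rewrite mulr0 (_ : (fun m => _) = fun=> 0); first exact: cvg_cst.
  by apply/funext => m; rewrite mulr0.
have kylW : k0^T *m yl \in W.
  have [C WC] := vspace_kernel_mx W; rewrite WC mem_kernel_mx; apply/eqP.
  have c1 : (fun m => C *m (((kq m).1)^T *m ym m)) @ F --> C *m (k0^T *m yl).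
    apply: (@cvg_mulmx _ _ F _ _ _ _ (fun=> C)); first exact: cvg_cst.
    by apply: cvg_mulmx => //; exact: cvg_trmx.
  apply/esym; apply: (@cvg_cst_eq _ _ _ F); move: c1.
  rewrite (_ : (fun m => _) = fun=> 0) //; apply/funext => m.
  by apply/eqP; rewrite -mem_kernel_mx -WC.
have ylW : yl \in W.
  have [_ k2] := compactK_orthogonal Kk0.
  by rewrite -[yl]mul1mx -k2 -mulmxA; exact: Gplus_stab kylW.
have yli0 : (U *m yl) i0 0 != 0 by rewrite spectral_proj_coord eqxx mul1r.
have di0l : d 0 i0 = l.
  by apply/eqP; apply: contraNT yli0 => dl; apply/eqP; exact: Wl.
suff -> : y = yl by [].
apply: frame_inj => i; rewrite !spectral_proj_coord di0l -di0l.
by have [dlt|/high ->|_] := ltgtP (d 0 i) (d 0 i0); rewrite ?mulr0.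
Qed.

Lemma near_identity_coords : \forall g \near (1%:M : 'M[R]_n),
  forall i j, `|frame_coords U g i j - (i == j)%:R| <= (n%:R * 2)^-1.
Proof.
have /cvg_mxP c : (fun g => frame_coords U g) @ (1%:M : 'M[R]_n) --> frame_coords U 1%:M.
  by apply: (@cvg_frame_coords _ _ _ (nbhs (1%:M : 'M[R]_n)) _ _ (fun y => y)); exact: cvg_id.
apply: (@filter_forall _ _ _ (nbhs (1%:M : 'M[R]_n))) => i.
apply: (@filter_forall _ _ _ (nbhs (1%:M : 'M[R]_n))) => j.
have n0 : (0 : R) < (n%:R * 2)^-1.
  by rewrite invr_gt0 mulr_gt0 // ltr0n (leq_trans _ (ltn_ord i)).
have /cvgrPdist_le/(_ _ n0) := c i j.
apply: filterS => g; rewrite /frame_coords mulmx1 oU.2 [X in X - _]mxE distrC.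
by rewrite -mulr_natr mul1r.
Qed.

(** The vectors [g w] with [g] near the identity and [w] in [W] span the whole
    space, and their components above the eigenvalue [l] of [W] lie in [W]. *)
Theorem admissible_top (v : 'cV[R]_n) :
  v \in W <-> forall i j, d 0 i < d 0 j -> (U *m v) i 0 = 0.
Proof.
have [l [[i0 di0] Wl]] := admissible_single_eigenvalue; have [W0 _] := W_irr.
pose Z := spectral_proj (fun x => l <= x).
have ZW u : Z *m u \in W.
  have [C WC] := vspace_kernel_mx W.
  have : kernel_mx (C *m Z) = fullv.
    apply: (near_identity_spanning G_subgroup G_connected G_irr W0).
    apply: (@filterS _ (nbhs (1%:M : 'M[R]_n)) _ _ _ _ near_identity_coords) => g gn Gg w wW.
    rewrite mem_kernel_mx -mulmxA -mem_kernel_mx -WC.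
    by apply: near_identity_leading_part => //; split=> //; exists i0.
  move=> CZ; have := memvf u; rewrite -CZ mem_kernel_mx -mulmxA.
  by rewrite -mem_kernel_mx -WC.
split=> [vW i j dij|vi].
  have [dil|] := eqVneq (d 0 i) l; last exact: Wl.
  have /Wl/(_ j) : Z *m (U^T *m delta_mx j 0) \in W by exact: ZW.
  rewrite spectral_proj_coord mulmxA oU.2 mul1mx mxE !eqxx mulr1 -dil (ltW dij).
  rewrite gt_eqF // => /(_ isT)/eqP.
  by rewrite oner_eq0.
suff -> : v = Z *m v by [].
apply: frame_inj => i; rewrite spectral_proj_coord.
have [_|dl] := leP l (d 0 i); first by rewrite mul1r.
by rewrite mul0r (vi i i0) // di0.
Qed.

End Admissible.

(** * Invariant scalar products *)

Section ScalarProduct.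
Variables (R : realType) (n : nat) (dot : 'M[Cplx R]_n -> 'M[Cplx R]_n -> R).
Hypothesis dotP : Ad_invariant_scalar_product dot.
Implicit Types (X Y Z : 'M[R]_n).

Definition ip X Y : R := dot (cplx_mx X) (cplx_mx Y).

Lemma cplx_mxM m p q (A : 'M[R]_(m, p)) (B : 'M[R]_(p, q)) :
  cplx_mx (A *m B) = cplx_mx A *m cplx_mx B.
Proof. exact: map_mxM. Qed.

Lemma cplx_mx1 : cplx_mx (1%:M : 'M[R]_n) = 1%:M.
Proof. exact: map_mx1. Qed.

Lemma cplx_mx_comb a X Y : cplx_mx (a *: X + Y) = toC a *: cplx_mx X + cplx_mx Y.
Proof. by rewrite /cplx_mx map_mxD map_mxZ. Qed.

Lemma conj_toC (a : R) : (toC a)^* = toC a.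
Proof. by apply/CrealP/complex_realP; exists a. Qed.

Lemma isu_cplx_mx X : Sym0 X -> isu (cplx_mx X).
Proof.
move=> [XT trX]; split; last by rewrite /cplx_mx trace_map_mx trX rmorph0.
apply/is_hermitianmxP; rewrite expr0 scale1r; apply/matrixP => i j.
by rewrite !mxE conj_toC -[in LHS]XT mxE.
Qed.

Lemma Sym0_comb a X Y : Sym0 X -> Sym0 Y -> Sym0 (a *: X + Y).
Proof.
move=> [XT trX] [YT trY]; split; first by rewrite linearP /= XT YT.
by rewrite linearP /= trX trY mulr0 addr0.
Qed.

Lemma Sym0_0 : Sym0 (0 : 'M[R]_n).
Proof. by split; rewrite ?trmx0 ?mxtrace0. Qed.

Lemma ip_comb a X Y Z : Sym0 X -> Sym0 Y -> Sym0 Z -> ip (a *: X + Y) Z = a * ip X Z + ip Y Z.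
Proof.
by case: dotP => + _ _ _ => h *; rewrite /ip cplx_mx_comb h //; exact: isu_cplx_mx.
Qed.

Lemma ipC X Y : Sym0 X -> Sym0 Y -> ip X Y = ip Y X.
Proof. by case: dotP => _ + _ _ => h *; apply: h; exact: isu_cplx_mx. Qed.

Lemma ip_gt0 X : Sym0 X -> X != 0 -> 0 < ip X X.
Proof.
case: dotP => _ _ + _ => h sX X0; apply: h; first exact: isu_cplx_mx.
apply: contraNneq X0 => /matrixP X0; apply/eqP/matrixP => i j.
by have := X0 i j; rewrite !mxE => /eqP; rewrite fmorph_eq0 => /eqP.
Qed.

Lemma ip0l Z : Sym0 Z -> ip 0 Z = 0.
Proof.
move=> sZ; have := ip_comb 1 Sym0_0 Sym0_0 sZ; rewrite scale1r addr0 mul1r.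
by move=> /eqP; rewrite -subr_eq0 opprD addNKr oppr_eq0 => /eqP.
Qed.

Lemma ipB X Y Z : Sym0 X -> Sym0 Y -> Sym0 Z -> ip (X - Y) Z = ip X Z - ip Y Z.
Proof.
by move=> sX sY sZ; rewrite addrC -scaleN1r ip_comb // mulN1r addrC.
Qed.

Lemma Sym0B X Y : Sym0 X -> Sym0 Y -> Sym0 (X - Y).
Proof. by move=> sX sY; rewrite addrC -scaleN1r; exact: Sym0_comb. Qed.

Lemma ip_ge0 X : Sym0 X -> 0 <= ip X X.
Proof.
move=> sX; have [->|/(ip_gt0 sX)/ltW//] := eqVneq X 0.
by rewrite ip0l //; exact: Sym0_0.
Qed.

Lemma ip_eq0 X : Sym0 X -> ip X X = 0 -> X = 0.
Proof. by move=> sX X0; apply: contrapT => /eqP/(ip_gt0 sX); rewrite X0 ltxx. Qed.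

Lemma ip_sqrB X Y : Sym0 X -> Sym0 Y -> ip (X - Y) (X - Y) = ip X X - 2 * ip X Y + ip Y Y.
Proof.
move=> sX sY; have sXY := Sym0B sX sY.
rewrite ipB // [ip X _]ipC // [ip Y _]ipC // !ipB // [ip Y X]ipC //; ring.
Qed.

Lemma SUn_cplx_mx (k : 'M[R]_n) : SOn k -> @SUn R n (cplx_mx k).
Proof.
move=> [k1 kd]; split; last by rewrite /cplx_mx det_map_mx kd rmorph1.
apply/unitarymxP; have [_ k2] := orthogonalmxP k1.
rewrite (_ : (cplx_mx k) ^t* = cplx_mx k^T); first by rewrite -cplx_mxM k2 cplx_mx1.
by apply/matrixP => i j; rewrite !mxE conj_toC.
Qed.

Lemma cplx_mx_Ad (k : 'M[R]_n) X : cplx_mx (Ad k X) = Ad (cplx_mx k) (cplx_mx X).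
Proof. by rewrite /Ad !cplx_mxM /cplx_mx map_invmx. Qed.

Lemma ip_Ad (k : 'M[R]_n) X Y : SOn k -> Sym0 X -> Sym0 Y -> ip (Ad k X) (Ad k Y) = ip X Y.
Proof.
case: dotP => _ _ _ + => h Sk sX sY; rewrite /ip !cplx_mx_Ad h //.
- exact: SUn_cplx_mx.
- exact: isu_cplx_mx.
- exact: isu_cplx_mx.
Qed.

Lemma SOn_inv (k : 'M[R]_n) : SOn k -> invmx k = k^T.
Proof.
move=> [k1 kd]; have ku : k \in unitmx by rewrite unitmxE kd unitr1.
by rewrite -[invmx k]mul1mx -k1 -mulmxA mulmxV // mulmx1.
Qed.

End ScalarProduct.

Section Killing.
Variables (R : realType) (n : nat) (dot : 'M[Cplx R]_n.+1 -> 'M[Cplx R]_n.+1 -> R).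
Hypothesis dotP : Ad_invariant_scalar_product dot.
Notation ip := (ip dot).

(** The sign gives this transposition matrix determinant one. *)
Definition signed_swap (i : 'I_n.+1) : 'M[R]_n.+1 :=
  diag_mx (\row_j (-1) ^+ (j == i)) *m tperm_mx i 0.

Lemma signed_swap_SOn i : i != 0 -> SOn (signed_swap i).
Proof.
move=> i0; split.
  rewrite trmx_mul mulmxA -(mulmxA _ _ (diag_mx _)) tr_diag_mx mulmx_diag.
  rewrite (_ : diag_mx _ = 1%:M).
    by rewrite mulmx1 /tperm_mx tr_perm_mx -perm_mxM mulVg perm_mx1.
  rewrite -diag_const_mx; congr diag_mx; apply/matrixP => a b; rewrite !mxE.
  by case: (b == i); rewrite ?expr1 ?expr0 ?mulr1 ?mulrNN ?mulr1.
rewrite det_mulmx det_diag det_perm odd_tperm i0 expr1 (bigD1 i) //= mxE eqxx expr1.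
rewrite big1 ?mulr1 ?mulrNN ?mulr1 // => j ji.
by rewrite mxE (negbTE ji) expr0.
Qed.

(** [E_ii - E_00]. *)
Definition coroot (i : 'I_n.+1) : 'M[R]_n.+1 := diag_mx (\row_j ((j == i)%:R - (j == 0)%:R)).

Lemma Sym0_diag (d : 'rV[R]_n.+1) : \sum_i d 0 i = 0 -> Sym0 (diag_mx d).
Proof. by move=> sd; split; [exact: tr_diag_mx | rewrite mxtrace_diag]. Qed.

Lemma Sym0_coroot i : Sym0 (coroot i).
Proof.
apply: Sym0_diag; under eq_bigr do rewrite mxE; rewrite sumrB.
rewrite (bigD1 i) //= eqxx big1 => [|j /negbTE ->//].
rewrite (bigD1 0) //= big1 => [|j /negbTE ->//].
by rewrite !addr0 subrr.
Qed.

Lemma Ad_signed_swap i (d : 'rV[R]_n.+1) : i != 0 ->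
  Ad (signed_swap i) (diag_mx d) = (- (d 0 i - d 0 0)) *: coroot i + diag_mx d.
Proof.
move=> i0; have [s1 s2] := signed_swap_SOn i0.
have su : signed_swap i \in unitmx by rewrite unitmxE s2 unitr1.
rewrite -[RHS](mulmxK su) /Ad; congr (_ *m _).
apply/matrixP => a b; rewrite /signed_swap mulmxA -mulmxA mul_mx_diag mulmxDl -scalemxAl.
rewrite /coroot !mulmxA !mulmx_diag !mul_diag_mx !mxE.
have [->|ai] := eqVneq a i; first rewrite tpermL.
  rewrite (negbTE i0) subr0 mulr1n; case: eqVneq => [<-|]; rewrite ?mulr0 ?mul0r ?mulr0 ?addr0 //.
  by rewrite /= !mulr1; ring.
have [->|a0] := eqVneq a 0; first rewrite tpermR.
  by case: eqVneq => [<-|] /=; rewrite ?mulr0 ?mul0r ?addr0 //; ring.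
rewrite tpermD 1?eq_sym //; case: eqVneq => [<-|] /=; rewrite ?mulr0 ?mul0r ?addr0 //; ring.
Qed.

(** The signed transposition negates the coroot and subtracts [d_i - d_0] times it
    from [diag d]; compare the scalar products before and after. *)
Lemma ip_diag_coroot i (d : 'rV[R]_n.+1) : \sum_j d 0 j = 0 -> i != 0 ->
  2 * ip (diag_mx d) (coroot i) = (d 0 i - d 0 0) * ip (coroot i) (coroot i).
Proof.
move=> sd i0; have sD := Sym0_diag sd; have sH := Sym0_coroot i.
have AdH : Ad (signed_swap i) (coroot i) = (-2) *: coroot i + coroot i.
  rewrite {1}/coroot Ad_signed_swap //; congr (_ *: _ + _); rewrite !mxE !eqxx (negbTE i0).
  by rewrite eq_sym (negbTE i0); rewrite /=; ring.
have := ip_Ad dotP (signed_swap_SOn i0) sD sH.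
rewrite AdH Ad_signed_swap //; set a := - (d 0 i - d 0 0).
have sH2 := Sym0_comb (-2) sH sH.
rewrite (ip_comb dotP) // [ip (coroot i) (_ + _)](ipC dotP) //.
rewrite [ip (diag_mx d) (_ + _)](ipC dotP) //.
rewrite !(ip_comb dotP) // [ip (coroot i) (diag_mx d)](ipC dotP) // /a => E; lra.
Qed.

Lemma ip_coroot i j : i != 0 -> j != 0 -> ip (coroot i) (coroot i) = ip (coroot j) (coroot j).
Proof.
move=> i0 j0; have [-> //|ij] := eqVneq i j.
have sc l : \sum_l' (\row_k ((k == l)%:R - (k == 0)%:R) : 'rV[R]_n.+1) 0 l' = 0.
  by have [_] := Sym0_coroot l; rewrite mxtrace_diag.
have := ip_diag_coroot (sc i) j0; have := ip_diag_coroot (sc j) i0.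
rewrite !mxE !eqxx (negbTE i0) (negbTE j0) [0 == i]eq_sym [0 == j]eq_sym (negbTE i0) (negbTE j0).
rewrite [j == i]eq_sym (negbTE ij) -!/(coroot _) [ip (coroot j) (coroot i)](ipC dotP).
- by rewrite /=; lra.
- exact: Sym0_coroot.
- exact: Sym0_coroot.
Qed.

Lemma ip_sum (a : 'I_n.+1 -> R) (X : 'I_n.+1 -> 'M[R]_n.+1) Z :
  (forall i, Sym0 (X i)) -> Sym0 Z -> ip (\sum_i a i *: X i) Z = \sum_i a i * ip (X i) Z.
Proof.
move=> sX sZ; suff [] : Sym0 (\sum_i a i *: X i) /\
  ip (\sum_i a i *: X i) Z = \sum_i a i * ip (X i) Z by [].
elim: (index_enum _) => [|i r [sr IH]].
  by rewrite !big_nil ip0l //; split=> //; exact: Sym0_0.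
by rewrite !big_cons (ip_comb dotP) // IH; split=> //; exact: Sym0_comb.
Qed.

Lemma ip_diag : exists2 c : R, 0 < c &
  forall d : 'rV[R]_n.+1, \sum_i d 0 i = 0 ->
    ip (diag_mx d) (diag_mx d) = c * \sum_i d 0 i ^+ 2.
Proof.
have [c c0 cE] : exists2 c : R, 0 < c & forall i, i != 0 -> ip (coroot i) (coroot i) = 2 * c.
  have [[i1 i10]|no] := pselect (exists i : 'I_n.+1, i != 0); last first.
    by exists 1 => // i i0; case: no; exists i.
  exists (ip (coroot i1) (coroot i1) / 2) => [|i i0]; last first.
    by rewrite (ip_coroot i0 i10); field.
  rewrite divr_gt0 //; apply: (ip_gt0 dotP); first exact: Sym0_coroot.
  apply/eqP => /matrixP/(_ i1 i1)/eqP; rewrite !mxE !eqxx (negbTE i10) subr0 mulr1n.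
  by rewrite oner_eq0.
exists c => // d sd; have sD := Sym0_diag sd.
have DE : diag_mx d = \sum_i d 0 i *: coroot i.
  apply/matrixP => a b; rewrite summxE [LHS]mxE.
  under eq_bigr do rewrite /coroot !mxE.
  have [->|ab] := eqVneq a b; last by rewrite mulr0n big1 // => i _; rewrite mulr0n mulr0.
  rewrite mulr1n; under eq_bigr do rewrite mulr1n mulrBr.
  rewrite sumrB -mulr_suml sd mul0r subr0 (bigD1 b) //= eqxx mulr1 big1 ?addr0 // => i ib.
  by rewrite eq_sym (negbTE ib) mulr0.
rewrite {1}DE ip_sum //; last by move=> i; exact: Sym0_coroot.
have term i : d 0 i * ip (coroot i) (diag_mx d) = c * d 0 i ^+ 2 - c * d 0 0 * d 0 i.
  have [->|i0] := eqVneq i 0.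
    rewrite (_ : coroot 0 = 0); first by rewrite (ip0l dotP) //; ring.
    by apply/matrixP => a b; rewrite !mxE subrr mul0rn.
  rewrite (ipC dotP) //; last exact: Sym0_coroot.
  by have := ip_diag_coroot sd i0; rewrite cE // => E; nra.
rewrite (eq_bigr _ (fun i _ => term i)) sumrB -!mulr_sumr sd; ring.
Qed.

(** Up to a positive factor, an invariant scalar product is the trace form: it
    suffices to compare them on diagonal matrices, where invariance under signed
    transpositions determines the products of the coroots [E_ii - E_00]. *)
Theorem ip_frobenius : exists2 c : R, 0 < c &
  forall X : 'M[R]_n.+1, Sym0 X -> ip X X = c * \sum_i \sum_j X i j ^+ 2.
Proof.
have [c c0 cE] := ip_diag; exists c => // X sX; have [XT trX] := sX.
have [V [d [oV XE]]] := spectral_theorem XT.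
have [U [oU dU XU]] : exists U : 'M[R]_n.+1, [/\ orthogonalmx U, \det U = 1 &
    X = U^T *m diag_mx d *m U].
  have : (\det V) ^+ 2 = 1.
    by have /(congr1 determinant) := oV.1; rewrite det_mulmx det_tr det1 expr2.
  move=> /eqP; rewrite sqrf_eq1 => /orP[/eqP dV|/eqP dV]; first by exists V.
  (* A frame of determinant -1 is corrected by a sign. *)
  pose S : 'M[R]_n.+1 := diag_mx (\row_j (-1) ^+ (j == 0)).
  have SS : S *m S = 1%:M.
    rewrite mulmx_diag -diag_const_mx; congr diag_mx; apply/matrixP => a b; rewrite !mxE.
    by case: (b == 0); rewrite ?expr1 ?expr0 ?mulr1 ?mulrNN ?mulr1.
  have ST : S^T = S by rewrite tr_diag_mx.
  have oS : orthogonalmx S by split; rewrite ST.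
  exists (S *m V); split; first exact: orthogonalmxM.
    rewrite det_mulmx dV det_diag (bigD1 0) //= mxE eqxx expr1 big1 ?mulr1 ?mulrNN ?mulr1 //.
    by move=> j j0; rewrite mxE (negbTE j0) expr0.
  rewrite trmx_mul ST -!mulmxA [S *m (diag_mx d *m _)]mulmxA /S diag_mxC -/S.
  by rewrite -!mulmxA (mulmxA S S) SS mul1mx mulmxA.
have SU : SOn U^T by split; [rewrite trmxK; case: oU | rewrite det_tr].
have XA : X = Ad U^T (diag_mx d) by rewrite /Ad SOn_inv // trmxK.
have sd : \sum_i d 0 i = 0.
  by rewrite -mxtrace_diag -trX XU mxtrace_mulC mulmxA oU.2 mul1mx.
have -> : ip X X = c * \sum_i d 0 i ^+ 2.
  by rewrite XA (ip_Ad dotP) ?cE //; exact: Sym0_diag.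
congr (_ * _); transitivity (\tr (diag_mx d *m diag_mx d)).
  by rewrite mulmx_diag mxtrace_diag; apply: eq_bigr => i _; rewrite !mxE expr2.
have -> : \tr (diag_mx d *m diag_mx d) = \tr (X *m X).
  rewrite XU !mulmxA -(mulmxA _ U) oU.2 mulmx1 -(mulmxA U^T) [in RHS]mxtrace_mulC.
  by rewrite !mulmxA oU.2 mul1mx.
apply: eq_bigr => i _; rewrite mxE; apply: eq_bigr => j _.
by rewrite -{2}XT mxE expr2.
Qed.

End Killing.

(** * Complex vectors in real coordinates *)

Section ComplexCoordinates.
Variable R : realType.
Local Notation C := (Cplx R).
Implicit Types (z w : C) (a : R).

Definition re z : R := complex.Re z.
Definition im z : R := complex.Im z.

Lemma reD z w : re (z + w) = re z + re w. Proof. by case: z; case: w. Qed.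
Lemma imD z w : im (z + w) = im z + im w. Proof. by case: z; case: w. Qed.

Lemma re_toC a : re (toC a) = a. Proof. by []. Qed.

Lemma re_sum (I : Type) (r : seq I) (f : I -> C) : re (\sum_(i <- r) f i) = \sum_(i <- r) re (f i).
Proof. by elim: r => [|i r IH]; rewrite ?big_nil // !big_cons reD IH. Qed.

Lemma im_sum (I : Type) (r : seq I) (f : I -> C) : im (\sum_(i <- r) f i) = \sum_(i <- r) im (f i).
Proof. by elim: r => [|i r IH]; rewrite ?big_nil // !big_cons imD IH. Qed.

Lemma re_toCM a z : re (toC a * z) = a * re z.
Proof. by case: z => x y; rewrite /re /= mul0r subr0. Qed.

Lemma im_toCM a z : im (toC a * z) = a * im z.
Proof. by case: z => x y; rewrite /im /= mul0r addr0. Qed.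

Definition nsq z : R := re z ^+ 2 + im z ^+ 2.

Lemma conj_mul_nsq z : z^* * z = toC (nsq z).
Proof. by rewrite mulrC -normCK /toC /nsq /re /im -[LHS](@add_Re2_Im2 R z). Qed.

Lemma re_conjM z w : re (z^* * w) = re z * re w + im z * im w.
Proof. by case: z w => [x y] [x' y']; rewrite /re /im /= mulNr opprK. Qed.

Lemma nsq_ge0 z : 0 <= nsq z.
Proof. by rewrite addr_ge0 ?sqr_ge0. Qed.

Lemma nsq_eq0 z : (nsq z == 0) = (z == 0).
Proof.
apply/eqP/eqP => [h|->]; last by rewrite /nsq /re /im /= expr0n addr0.
have : toC (nsq z) = 0 by rewrite h.
by rewrite -conj_mul_nsq => /eqP; rewrite mulf_eq0 conjC_eq0 orbb => /eqP.
Qed.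

Lemma nsq_toCM a z : nsq (toC a * z) = a ^+ 2 * nsq z.
Proof. by rewrite /nsq re_toCM im_toCM !exprMn mulrDr. Qed.

Lemma re_continuous : continuous re.
Proof.
move=> z; apply/(@cvgrPdist_lt _ _ _ (nbhs z) (nbhs_filter z)) => e e0.
have e0' : (0 : C) < toC e by rewrite /toC ltcR.
have nz : nbhs z (ball z (toC e)) by exact: nbhsx_ballx.
apply: (@filterS _ (nbhs z) (nbhs_filter z) _ _ _ nz) => w zw; rewrite -ltcR; apply: le_lt_trans zw.
have -> : re z - re w = re (z - w) by case: (z); case: (w).
exact: (@normc_ge_Re R (z - w)).
Qed.

Lemma im_continuous : continuous im.
Proof.
move=> z; apply/(@cvgrPdist_lt _ _ _ (nbhs z) (nbhs_filter z)) => e e0.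
have e0' : (0 : C) < toC e by rewrite /toC ltcR.
have nz : nbhs z (ball z (toC e)) by exact: nbhsx_ballx.
apply: (@filterS _ (nbhs z) (nbhs_filter z) _ _ _ nz) => w zw; rewrite -ltcR; apply: le_lt_trans zw.
have -> : `|im z - im w| = `|re ('i * (z - w))|.
  by case: (z) (w) => [a b] [a' b']; rewrite /re /im /= mul0r mul1r sub0r normrN.
apply: le_trans (@normc_ge_Re R _) _.
by rewrite normrM normCi mul1r.
Qed.

Variable n : nat.
Implicit Types (x : 'cV[C]_n) (A U : 'M[R]_n) (d : 'rV[R]_n).

Definition sq x : R := \sum_i nsq (x i 0).

Lemma hermitian_prod x A : (x^t* *m cplx_mx A *m x) 0 0 =
  \sum_i \sum_j (x i 0)^* * toC (A i j) * x j 0.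
Proof.
rewrite mxE exchange_big /=; apply: eq_bigr => j _; rewrite mxE mulr_suml.
by apply: eq_bigr => i _; rewrite !mxE.
Qed.

Lemma hermitian_sq x : (x^t* *m x) 0 0 = toC (sq x).
Proof.
by rewrite mxE rmorph_sum; apply: eq_bigr => i _; rewrite !mxE conj_mul_nsq.
Qed.

Lemma sq_gt0 x : x != 0 -> 0 < sq x.
Proof.
move=> x0; rewrite lt_neqAle eq_sym sumr_ge0 ?andbT; last by move=> i _; exact: nsq_ge0.
apply: contraNneq x0 => /eqP; rewrite psumr_eq0; last by move=> i _; exact: nsq_ge0.
move=> /allP x0; apply/eqP/matrixP => i j; rewrite ord1 mxE; apply/eqP.
by rewrite -nsq_eq0; exact: (x0 i (mem_index_enum _)).
Qed.

Lemma re_hermitian_prod x A : re ((x^t* *m cplx_mx A *m x) 0 0) =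
  \sum_i \sum_j A i j * (re (x i 0) * re (x j 0) + im (x i 0) * im (x j 0)).
Proof.
rewrite hermitian_prod re_sum; apply: eq_bigr => i _; rewrite re_sum; apply: eq_bigr => j _.
by rewrite -mulrA mulrCA re_toCM re_conjM.
Qed.

Lemma adj_cplx_mulmx U x : (cplx_mx U *m x)^t* = x^t* *m cplx_mx U^T.
Proof.
rewrite trmx_mul map_mxM; congr (_ *m _).
by apply/matrixP => i j; rewrite !mxE; exact: conj_toC.
Qed.

Lemma hermitian_prod_framed U d A x : framed U d A ->
  (x^t* *m cplx_mx A *m x) 0 0 = toC (\sum_i d 0 i * nsq ((cplx_mx U *m x) i 0)).
Proof.
move=> [oU ->]; set y := cplx_mx U *m x.
have -> : x^t* *m cplx_mx (U^T *m diag_mx d *m U) *m x = y^t* *m cplx_mx (diag_mx d) *m y.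
  by rewrite adj_cplx_mulmx !cplx_mxM !mulmxA.
rewrite hermitian_prod rmorph_sum; apply: eq_bigr => i _.
rewrite (bigD1 i) //= big1 => [|j ji]; last first.
  by rewrite !mxE eq_sym (negbTE ji) mulr0n rmorph0 mulr0 mul0r.
by rewrite addr0 !mxE eqxx mulr1n mulrAC conj_mul_nsq mulrC -rmorphM.
Qed.

Lemma sq_framed U x : orthogonalmx U -> sq (cplx_mx U *m x) = sq x.
Proof.
move=> oU; apply: (@complexI R); rewrite -![_%:C%C]/(toC _) -!hermitian_sq.
rewrite adj_cplx_mulmx.
by rewrite -mulmxA (mulmxA _ (cplx_mx U)) -cplx_mxM oU.1 cplx_mx1 mul1mx.
Qed.

End ComplexCoordinates.

(** * Continuity on the projective space *)

Section Projective.
Variables (R : realType) (n : nat).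
Local Notation C := (Cplx R).
Local Notation vec := (nonzero_vec (K := C) (n := n)).

Lemma line_of_surj (x : projective_space C n) : exists v : vec, x = line_of v.
Proof. by exists (repr x); rewrite /line_of reprK. Qed.

Lemma line_ofP (v w : vec) : line_of v = line_of w <-> exists a : C, set_val v = a *: set_val w.
Proof.
split=> [/eqmodP/asboolP //|h]; apply/eqmodP; exact/asboolP.
Qed.

Lemma vec_neq0 (v : vec) : set_val v != 0.
Proof. exact: set_mem (valP v). Qed.

Lemma vec_exists (z : 'cV[C]_n) : z != 0 -> exists v : vec, set_val v = z.
Proof. by move=> z0; exists (SigSub (mem_set z0 : z \in vec)). Qed.

Lemma cplx_mulmx_neq0 (g : 'M[R]_n) (z : 'cV[C]_n) :
  g \in unitmx -> z != 0 -> cplx_mx g *m z != 0.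
Proof.
move=> gu; apply: contra_neq => gz; rewrite -[z]mul1mx -(cplx_mx1 R n) -(mulVmx gu).
by rewrite cplx_mxM -mulmxA gz mulmx0.
Qed.

Lemma vec_act (g : 'M[R]_n) (v : vec) : g \in unitmx ->
  exists w : vec, set_val w = cplx_mx g *m set_val v.
Proof. by move=> gu; apply/vec_exists/cplx_mulmx_neq0 => //; exact: vec_neq0. Qed.

Lemma vec_inhabited (v : vec) : exists i : 'I_n, True.
Proof.
have := vec_neq0 v; case: (n) v => [v|n' _ _]; last by exists 0.
by move=> /eqP[]; apply/matrixP => -[].
Qed.

(** The real part of the orthogonal projection [z z^* / |z|^2] onto the line of [z].
    It is symmetric, so transposed conventions give the same matrix. *)
Definition rho (v : vec) i j : R :=
  (re (set_val v i 0) * re (set_val v j 0) + im (set_val v i 0) * im (set_val v j 0))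
  / sq (set_val v).

Lemma set_val_continuous : continuous (set_val : vec -> 'cV[C]_n).
Proof. exact: initial_continuous. Qed.

Lemma coord_vec_continuous i : continuous (fun v : vec => set_val v i 0 : C).
Proof.
move=> v; apply: (cvg_comp (set_val : vec -> 'cV[C]_n) (fun z : 'cV[C]_n => z i 0)).
  exact: set_val_continuous.
exact: coord_continuous.
Qed.

Lemma re_vec_continuous i : continuous (fun v : vec => re (set_val v i 0)).
Proof.
move=> v; apply: (cvg_comp (fun v : vec => set_val v i 0 : C) (@re R)).
  exact: coord_vec_continuous.
exact: re_continuous.
Qed.

Lemma im_vec_continuous i : continuous (fun v : vec => im (set_val v i 0)).
Proof.
move=> v; apply: (cvg_comp (fun v : vec => set_val v i 0 : C) (@im R)).
  exact: coord_vec_continuous.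
exact: im_continuous.
Qed.

Lemma rho_continuous i j : continuous (fun v : vec => rho v i j).
Proof.
have c a b : continuous (fun v : vec => re (set_val v a 0) * re (set_val v b 0) +
    im (set_val v a 0) * im (set_val v b 0)).
  move=> v; apply: (@cvgD R R vec (nbhs v) (nbhs_filter v)).
    by apply: (@cvgM R vec (nbhs v) (nbhs_filter v)); exact: re_vec_continuous.
  by apply: (@cvgM R vec (nbhs v) (nbhs_filter v)); exact: im_vec_continuous.
move=> v; apply: (@cvgM R vec (nbhs v) (nbhs_filter v)); first exact: c.
apply: cvgV; first by rewrite gt_eqF // sq_gt0 // vec_neq0.
apply: (@cvg_finsum R vec 'I_n (nbhs v) _ _ (fun i w => nsq (set_val w i 0))
  (fun i => nsq (set_val v i 0))) => l.
rewrite (_ : (fun w : vec => _) = fun w : vec => re (set_val w l 0) * re (set_val w l 0) +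
  im (set_val w l 0) * im (set_val w l 0)); last by apply/funext => w; rewrite /nsq !expr2.
by rewrite /nsq !expr2; exact: c.
Qed.

End Projective.

(** * The gradient map *)

Section Moment.
Variables (R : realType) (n : nat) (G : set 'M[R]_n).
Local Notation C := (Cplx R).
Local Notation vec := (nonzero_vec (K := C) (n := n)).
Hypotheses (G_subgroup : subgroup_of_SL G).
Variable dot : 'M[C]_n -> 'M[C]_n -> R.
Hypothesis dotP : Ad_invariant_scalar_product dot.
Variable mu : projective_space C n -> 'M[R]_n.
Hypothesis muP : gradient_map G dot mu.
Notation ip := (ip dot).
Implicit Types (v w : vec) (X Y : 'M[R]_n).

Lemma ip_frobenius_any : exists2 c : R, 0 < c &
  forall X : 'M[R]_n, Sym0 X -> ip X X = c * \sum_i \sum_j X i j ^+ 2.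
Proof.
move: (n) dot dotP => [|m] dot' dotP'; last exact: ip_frobenius.
exists 1 => // X sX; rewrite big_ord0 mulr0 (_ : X = 0) ?(ip0l dotP') //; first exact: Sym0_0.
by apply/matrixP => -[].
Qed.

Definition moment v : 'M[R]_n := mu (line_of v).

Lemma moment_sym v : sym_part G (moment v).
Proof. by case: (muP v). Qed.

Lemma sym_part_Sym0 X : sym_part G X -> Sym0 X. Proof. by case. Qed.

Lemma Sym0_moment v : Sym0 (moment v).
Proof. exact: sym_part_Sym0 (moment_sym v). Qed.

Lemma ip_moment v Y : sym_part G Y -> ip (moment v) Y = \sum_i \sum_j Y i j * rho v i j.
Proof.
move=> pY; have [_ /(_ Y pY)] := muP v; rewrite hermitian_sq => E.
rewrite -[LHS]re_toC /ip /moment E mulrC -fmorphV re_toCM re_hermitian_prod mulr_sumr.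
apply: eq_bigr => i _; rewrite mulr_sumr; apply: eq_bigr => j _.
by rewrite mulrCA /rho [X in _ * X]mulrC.
Qed.

Lemma ip_moment_framed U d v Y : sym_part G Y -> framed U d Y ->
  ip (moment v) Y * sq (set_val v) = \sum_i d 0 i * nsq ((cplx_mx U *m set_val v) i 0).
Proof.
move=> pY fY; have [_ /(_ Y pY)] := muP v.
rewrite hermitian_sq (hermitian_prod_framed _ fY) -fmorphV -rmorphM => /(@complexI R).
rewrite -/(moment v) -/(ip _ _) => ->.
by rewrite mulfVK // gt_eqF // sq_gt0 // vec_neq0.
Qed.

(** All terms are nonnegative when [M] bounds the eigenvalues; hence the bound on
    the height and the description of its maxima. *)
Lemma sum_moment_gap U d v Y M : sym_part G Y -> framed U d Y ->
  (M - ip (moment v) Y) * sq (set_val v) =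
  \sum_i (M - d 0 i) * nsq ((cplx_mx U *m set_val v) i 0).
Proof.
move=> pY fY; rewrite mulrBl (ip_moment_framed _ pY fY) -(sq_framed _ fY.1) /sq mulr_sumr -sumrB.
by apply: eq_bigr => i _; rewrite mulrBl.
Qed.

Lemma ip_moment_le U d v Y M : sym_part G Y -> framed U d Y ->
  (forall i, d 0 i <= M) -> ip (moment v) Y <= M.
Proof.
move=> pY fY dM; have s0 := sq_gt0 (vec_neq0 v).
rewrite -subr_ge0 -(pmulr_lge0 _ s0) (sum_moment_gap _ _ pY fY).
by apply: sumr_ge0 => i _; rewrite mulr_ge0 ?subr_ge0 ?nsq_ge0.
Qed.

Lemma ip_moment_top U d v Y M : sym_part G Y -> framed U d Y ->
  (forall i, d 0 i <= M) -> ip (moment v) Y = M <->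
  forall i, d 0 i < M -> (cplx_mx U *m set_val v) i 0 = 0.
Proof.
move=> pY fY dM; have s0 := sq_gt0 (vec_neq0 v).
have := sum_moment_gap v M pY fY => gap.
have ge0 i : 0 <= (M - d 0 i) * nsq ((cplx_mx U *m set_val v) i 0).
  by rewrite mulr_ge0 ?subr_ge0 ?nsq_ge0.
split=> [e i dlt|vi].
  have /eqP := gap; rewrite e subrr mul0r eq_sym psumr_eq0 // => /allP/(_ i (mem_index_enum _)) /=.
  by rewrite mulf_eq0 subr_eq0 gt_eqF //= nsq_eq0 => /eqP.
apply/esym/eqP; rewrite -subr_eq0 -(mulIr_eq0 _ (mulIf (lt0r_neq0 s0))) gap big1 // => i _.
have := dM i; rewrite le_eqVlt => /orP[/eqP->|/vi ->]; first by rewrite subrr mul0r.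
by rewrite /nsq /re /im /= expr0n addr0 mulr0.
Qed.

Lemma ip_inj X Y : sym_part G X -> sym_part G Y ->
  (forall Z, sym_part G Z -> ip X Z = ip Y Z) -> X = Y.
Proof.
move=> pX pY XY; have sX := sym_part_Sym0 pX; have sY := sym_part_Sym0 pY.
apply/eqP; rewrite -subr_eq0; apply/eqP/(ip_eq0 dotP); first exact: Sym0B.
by have := XY _ pX; have := XY _ pY; rewrite (ip_sqrB dotP) // [ip Y X](ipC dotP) //; lra.
Qed.

Lemma compactK_SOn k : compactK G k -> SOn k. Proof. by case. Qed.

Lemma AdM k h X : k \in unitmx -> h \in unitmx -> Ad (k *m h) X = Ad k (Ad h X).
Proof. move=> ku hu; rewrite /Ad; have khu : k *m h \in unitmx by rewrite unitmx_mul ku.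
have -> : invmx (k *m h) = invmx h *m invmx k; last by rewrite !mulmxA.
apply: (can_inj (mulKmx khu)).
by rewrite mulmxV // !mulmxA -(mulmxA k) mulmxV // mulmx1 mulmxV. Qed.

Lemma Ad1 X : Ad 1%:M X = X.
Proof. by rewrite /Ad invmx1 mulmx1 mul1mx. Qed.

Lemma moment_equivariant k v w : compactK G k ->
  set_val w = cplx_mx k *m set_val v -> moment w = Ad k (moment v).
Proof.
move=> Kk wv; have [k1 k2] := compactK_orthogonal Kk.
have ku := group_unit G_subgroup Kk.1.
have KT := compactK_tr G_subgroup Kk; have kTu := group_unit G_subgroup KT.1.
apply: ip_inj.
- exact: moment_sym.
- by apply: sym_part_Ad => //; exact: moment_sym.
move=> Z pZ; have pkZ : sym_part G (Ad k^T Z) by exact: sym_part_Ad.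
have -> : ip (Ad k (moment v)) Z = ip (moment v) (Ad k^T Z).
  rewrite -{1}[Z]Ad1 -k2 AdM //; apply: (ip_Ad dotP).
  - exact: compactK_SOn.
  - exact: Sym0_moment.
  - exact: sym_part_Sym0.
have sE : sq (set_val w) = sq (set_val v) by rewrite wv sq_framed.
apply: (@complexI R); have [_ /(_ _ pZ)] := muP w; have [_ /(_ _ pkZ)] := muP v.
rewrite !hermitian_sq sE -/(moment v) -/(moment w) -/(ip _ _) -/(ip _ _) /toC => -> ->.
congr (_ / _); rewrite wv adj_cplx_mulmx (Ad_compactK G_subgroup _ KT) trmxK.
by rewrite !cplx_mxM !mulmxA.
Qed.

(** The difference [D] of two moments satisfies [<D, D> = sum D_ij (rho_ij - rho'_ij)],
    and [<D, D>] is a positive multiple of the sum of the squares of the entries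
    of [D]; hence [D] is bounded by the variation of [rho]. *)
Lemma moment_coord_continuous i j : continuous (fun v => moment v i j).
Proof.
have [c c0 cE] := ip_frobenius_any.
pose S v w := \sum_a \sum_b `|rho v a b - rho w a b|.
have bound v w : `|moment v i j - moment w i j| <= c^-1 * S v w.
  pose D := moment v - moment w.
  have DE a b : D a b = moment v a b - moment w a b by rewrite !mxE.
  have sD : Sym0 D by apply: Sym0B; exact: Sym0_moment.
  case: (@arg_maxP _ R ('I_n * 'I_n)%type (i, j) xpredT (fun ab => `|D ab.1 ab.2|) isT).
  move=> [a0 b0] _ /= Dmax; pose M := `|D a0 b0|.
  have {}Dmax a b : `|D a b| <= M by exact: (Dmax (a, b)).
  have M0 : 0 <= M by exact: normr_ge0.
  have ipDm Y : sym_part G Y -> ip D Y = \sum_a \sum_b Y a b * (rho v a b - rho w a b).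
    move=> pY; rewrite /D (ipB dotP) ?ip_moment //; try exact: Sym0_moment.
      rewrite -sumrB; apply: eq_bigr => a _; rewrite -sumrB.
      by apply: eq_bigr => b _; rewrite mulrBr.
    exact: sym_part_Sym0.
  have ipD : ip D D = \sum_a \sum_b D a b * (rho v a b - rho w a b).
    have -> : ip D D = ip D (moment v) - ip D (moment w).
      rewrite (ipC dotP sD (Sym0_moment v)) (ipC dotP sD (Sym0_moment w)).
      by rewrite -(ipB dotP (Sym0_moment v) (Sym0_moment w) sD).
    rewrite !ipDm; try exact: moment_sym.
    rewrite -sumrB; apply: eq_bigr => a _; rewrite -sumrB.
    by apply: eq_bigr => b _; rewrite DE mulrBl.
  have upper : ip D D <= M * S v w.
    rewrite ipD /S mulr_sumr; apply: ler_sum => a _; rewrite mulr_sumr; apply: ler_sum => b _.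
    by apply: le_trans (ler_norm _) _; rewrite normrM ler_wpM2r.
  have lower : c * M ^+ 2 <= ip D D.
    rewrite cE // ler_pM2l // (bigD1 a0) //= (bigD1 b0) //= /M real_normK ?num_real //.
    rewrite -addrA lerDl addr_ge0 //; apply: sumr_ge0 => a _; first exact: sqr_ge0.
    by apply: sumr_ge0 => b _; exact: sqr_ge0.
  rewrite -DE; apply: le_trans (Dmax i j) _; rewrite ler_pdivlMl //.
  have [M00|Mn0] := eqVneq M 0.
    rewrite M00 mulr0; apply: sumr_ge0 => a _; apply: sumr_ge0 => b _; exact: normr_ge0.
  have Mpos : 0 < M by rewrite lt_neqAle eq_sym Mn0.
  by rewrite -(ler_pM2l Mpos) mulrCA -expr2; apply: le_trans lower upper.
move=> v; apply/(@cvgrPdist_le _ _ _ (nbhs v) (nbhs_filter v)) => e e0.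
have Sc : (fun w => c^-1 * S v w) @ nbhs v --> c^-1 * S v v.
  apply: (@cvgM R vec (nbhs v) (nbhs_filter v)); first exact: cvg_cst.
  apply: (@cvg_finsum R vec 'I_n (nbhs v) _ _ (fun a w => \sum_b `|rho v a b - rho w a b|)
    (fun a => \sum_b `|rho v a b - rho v a b|)) => a.
  apply: (@cvg_finsum R vec 'I_n (nbhs v) _ _ (fun b w => `|rho v a b - rho w a b|)
    (fun b => `|rho v a b - rho v a b|)) => b.
  apply: cvg_norm; apply: cvgB; first exact: cvg_cst.
  exact: rho_continuous.
have S0 : S v v = 0.
  by rewrite /S big1 // => a _; rewrite big1 // => b _; rewrite subrr normr0.
rewrite S0 mulr0 in Sc.
have /(@cvgrPdist_le _ _ _ (nbhs v) (nbhs_filter v))/(_ e e0) := Sc.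
apply: (@filterS _ (nbhs v) (nbhs_filter v)) => w; rewrite sub0r normrN => h.
by apply: le_trans (bound v w) _; apply: le_trans h; exact: ler_norm.
Qed.

End Moment.

(** * The compact orbit *)

Section Orbit.
Variables (R : realType) (n : nat) (G : set 'M[R]_n).
Local Notation C := (Cplx R).
Local Notation vec := (nonzero_vec (K := C) (n := n)).
Hypotheses (G_subgroup : subgroup_of_SL G) (G_closed : closed G)
  (G_polar : G = [set k *m expmx X | k in compactK G & X in sym_part G])
  (G_irr_C : irreducible_on (@cplx_mx R n n @` G) fullv).
Variable dot : 'M[C]_n -> 'M[C]_n -> R.
Hypothesis dotP : Ad_invariant_scalar_product dot.
Variable mu : projective_space C n -> 'M[R]_n.
Hypothesis muP : gradient_map G dot mu.
Variable O : set (projective_space C n).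
Hypothesis O_orbit : compact_proj_orbit (@cplx_mx R n n @` G) O.
Notation ip := (ip dot).
Notation moment := (moment mu).
Implicit Types (v w : vec) (X Y g k : 'M[R]_n).

Definition on_orbit v := O (line_of v).

Lemma orbit_base : exists v0, forall v, on_orbit v <->
  exists g w, [/\ G g, set_val w = cplx_mx g *m set_val v0 & line_of v = line_of w].
Proof.
have [_ [x0 OE]] := O_orbit; have [v0 x0E] := line_of_surj x0.
exists v0 => v; rewrite /on_orbit OE; split.
  move=> [h [z [w [[g Gg <-] xz vw wE]]]].
  have [a v0z] : exists a : C, set_val v0 = a *: set_val z by apply/line_ofP; rewrite -x0E.
  have [w' w'E] := vec_act v0 (group_unit G_subgroup Gg).
  exists g, w'; split=> //; rewrite vw; apply/esym/line_ofP; exists a.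
  by rewrite w'E v0z -scalemxAr -wE.
move=> [g [w [Gg wE vw]]]; exists (cplx_mx g), v0, w; split=> //; exists g.
Qed.

Lemma orbit_inhabited : exists v, on_orbit v.
Proof.
have [v0 v0P] := orbit_base; exists v0; apply/v0P; exists 1%:M, v0.
by split=> //; [exact: group1 | rewrite cplx_mx1 mul1mx].
Qed.

Lemma orbit_stable g v w : G g -> on_orbit v -> set_val w = cplx_mx g *m set_val v -> on_orbit w.
Proof.
have [v0 v0P] := orbit_base => Gg /v0P[h [u [Gh uE /line_ofP[a vu]]]] wE; apply/v0P.
have [u' u'E] := vec_act u (group_unit G_subgroup Gg).
exists (g *m h), u'; split; first exact: groupM.
  by rewrite u'E uE cplx_mxM mulmxA.
by apply/line_ofP; exists a; rewrite wE vu u'E -scalemxAr.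
Qed.

Lemma orbit_transitive v w : on_orbit v -> on_orbit w ->
  exists g u, [/\ G g, set_val u = cplx_mx g *m set_val v & line_of w = line_of u].
Proof.
have [v0 v0P] := orbit_base => /v0P[g [v' [Gg v'E /line_ofP[a vv']]]] /v0P[h [w' [Gh w'E ->]]].
have gu := group_unit G_subgroup Gg.
have Ghg : G (h *m invmx g) by apply: groupM => //; exact: groupV.
have [u uE] := vec_act v (group_unit G_subgroup Ghg).
exists (h *m invmx g), u; split=> //; apply/esym/line_ofP; exists a.
rewrite uE vv' -scalemxAr v'E w'E cplx_mxM -!mulmxA (mulmxA _ (cplx_mx g)) -cplx_mxM.
by rewrite mulVmx // cplx_mx1 mul1mx.
Qed.

(** The orbit spans the complex space by irreducibility. *)
Lemma orbit_component U i0 : orthogonalmx U ->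
  exists2 v, on_orbit v & (cplx_mx U *m set_val v) i0 0 != 0.
Proof.
move=> oU; apply: contrapT => none.
pose P (B : {vspace 'cV[C]_n}) := forall v, on_orbit v -> set_val v \in B.
have [||B PB Bmin] := @least_vspace C n P.
- by move=> v _; exact: memvf.
- by move=> V W PV PW v Ov; rewrite memv_cap PV // PW.
have B_stable (g : 'M[C]_n) : (@cplx_mx R n n @` G) g -> (act_vspace g B <= B)%VS.
  move=> [h Gh <-]; have hu := group_unit G_subgroup Gh.
  have hCu : cplx_mx h \in unitmx by rewrite map_unitmx.
  apply/act_vspace_subP; apply: (act_vspaceV_stable hCu); apply: Bmin => v Ov.
  have [w wE] := vec_act v hu; apply: mem_act_vspace_invmx => //.
  by rewrite -wE; exact: PB (orbit_stable Gh Ov wE).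
have [B0|BT] := G_irr_C.2 B (subvf _) B_stable.
  have [v Ov] := orbit_inhabited; have := PB _ Ov.
  by rewrite B0 memv0 (negbTE (vec_neq0 v)).
pose Z : 'M[C]_n := delta_mx i0 i0 *m cplx_mx U.
have ZE z : (Z *m z) i0 0 = (cplx_mx U *m z) i0 0.
  rewrite /Z -mulmxA mxE (bigD1 i0) //= big1 ?addr0 => [|j ji]; last first.
    by rewrite mxE (negbTE ji) andbF mul0r.
  by rewrite mxE !eqxx mul1r.
have BZ : (B <= kernel_mx Z)%VS.
  apply: Bmin => v Ov; rewrite mem_kernel_mx; apply/eqP/matrixP => i j; rewrite ord1 {j}.
  have [->|ii0] := eqVneq i i0.
    by rewrite ZE [RHS]mxE; apply: contrapT => /eqP vi; apply: none; exists v => //.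
  by rewrite /Z -mulmxA !mxE big1 // => j _; rewrite mxE (negbTE ii0) mul0r.
have := memvf ((cplx_mx U^T *m delta_mx i0 0) : 'cV[C]_n); rewrite -BT => /(subvP BZ).
rewrite mem_kernel_mx => /eqP/matrixP/(_ i0 0); rewrite ZE mulmxA -cplx_mxM oU.2 cplx_mx1 mul1mx.
by rewrite !mxE !eqxx => /eqP; rewrite oner_eq0.
Qed.

Definition top U (d : 'rV[R]_n) v :=
  forall i j, d 0 i < d 0 j -> (cplx_mx U *m set_val v) i 0 = 0.

Lemma max_index (d : 'rV[R]_n) : exists i0, forall i, d 0 i <= d 0 i0.
Proof.
have [v _] := orbit_inhabited; have [i1 _] := vec_inhabited v.
case: (@arg_maxP _ R 'I_n i1 xpredT (fun i => d 0 i) isT) => i0 _ imax.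
by exists i0 => i; exact: imax.
Qed.

Lemma topP U d v Y i0 : sym_part G Y -> framed U d Y -> (forall i, d 0 i <= d 0 i0) ->
  top U d v <-> ip (moment v) Y = d 0 i0.
Proof.
move=> pY fY dM; rewrite (ip_moment_top muP v pY fY dM).
by split=> h i; [move=> di; exact: h di | move=> j dij; apply: h; exact: lt_le_trans dij _].
Qed.

Lemma ip_moment_continuous Y : sym_part G Y -> continuous (fun x => ip (mu x) Y).
Proof.
move=> pY; apply/quotient_continuous => v.
rewrite (_ : _ \o _ = fun v => \sum_i \sum_j Y i j * rho v i j); last first.
  by apply/funext => w; rewrite /= -(ip_moment muP w pY).
apply: (@cvg_finsum R vec 'I_n (nbhs v) _ _ (fun i w => \sum_j Y i j * rho w i j)
    (fun i => \sum_j Y i j * rho v i j)) => i.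
apply: (@cvg_finsum R vec 'I_n (nbhs v) _ _ (fun j w => Y i j * rho w i j)
    (fun j => Y i j * rho v i j)) => j.
by apply: (@cvgM R vec (nbhs v) (nbhs_filter v)); [exact: cvg_cst | exact: rho_continuous].
Qed.

Lemma ip_moment_norm_continuous : continuous (fun x => ip (mu x) (mu x)).
Proof.
apply/quotient_continuous => v.
rewrite (_ : _ \o _ = fun v => \sum_i \sum_j moment v i j * rho v i j); last first.
  by apply/funext => w; rewrite /= -(ip_moment muP w (moment_sym muP w)).
apply: (@cvg_finsum R vec 'I_n (nbhs v) _ _ (fun i w => \sum_j moment w i j * rho w i j)
    (fun i => \sum_j moment v i j * rho v i j)) => i.
apply: (@cvg_finsum R vec 'I_n (nbhs v) _ _ (fun j w => moment w i j * rho w i j)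
    (fun j => moment v i j * rho v i j)) => j.
apply: (@cvgM R vec (nbhs v) (nbhs_filter v)); last exact: rho_continuous.
exact: (moment_coord_continuous dotP muP).
Qed.

Lemma orbit_max (f : projective_space C n -> R) : continuous f ->
  exists2 v, on_orbit v & forall w, on_orbit w -> f (line_of w) <= f (line_of v).
Proof.
move=> fc; have [v0 Ov0] := orbit_inhabited.
have O0 : O !=set0 by exists (line_of v0).
have [x xO xmax] := compact_EVT_max O0 O_orbit.1 (continuous_subspaceT fc).
have [v xE] := line_of_surj x; exists v; first by rewrite /on_orbit -xE; exact: set_mem.
by move=> w Ow; rewrite -xE; apply: xmax; exact: mem_set.
Qed.

(** The maximum of the height function of [Y] on the compact orbit is the largest
    eigenvalue of [Y]: otherwise flowing a generic point of the orbit by [exp (t Y)]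
    would exceed it. *)
Lemma orbit_top U d Y : sym_part G Y -> framed U d Y -> exists2 v, on_orbit v & top U d v.
Proof.
move=> pY fY; have [i0 dM] := max_index d.
have [v Ov vmax] := orbit_max (ip_moment_continuous pY).
exists v => //; apply/(topP v pY fY dM).
apply: le_anti; rewrite (ip_moment_le muP v pY fY dM) /= leNgt; apply/negP.
rewrite -/(moment v); set m := ip _ _ => mM.
have [w Ow wi0] := orbit_component i0 fY.1.
pose a i := nsq ((cplx_mx U *m set_val w) i 0).
have sum_le t : \sum_i (d 0 i - m) * (expR (t * (d 0 i - d 0 i0)) ^+ 2 * a i) <= 0.
  have Ge := sym_part_exp t pY.
  have [u uE] := vec_act w (group_unit G_subgroup Ge).
  have := vmax _ (orbit_stable Ge Ow uE); rewrite -/(moment u) -/m => um.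
  have := sum_moment_gap muP u m pY fY; have s0 := sq_gt0 (vec_neq0 u).
  have ui i : (cplx_mx U *m set_val u) i 0 = toC (expR (t * d 0 i)) * (cplx_mx U *m set_val w) i 0.
    have -> : cplx_mx U *m set_val u =
        cplx_mx (frame_coords U (expmx (t *: Y))) *m (cplx_mx U *m set_val w).
      rewrite uE /frame_coords !cplx_mxM !mulmxA -(mulmxA _ _ (cplx_mx U)) -(cplx_mxM U^T U) fY.1.1.
      by rewrite cplx_mx1 mulmx1.
    rewrite (frame_coords_expmx _ fY) [LHS]mxE (bigD1 i) //= big1 => [|j ji].
      by rewrite addr0 !mxE eqxx mulr1n.
    by rewrite !mxE eq_sym (negbTE ji) mulr0n rmorph0 mul0r.
  under eq_bigr do rewrite ui nsq_toCM -/(a _).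
  move=> E; have e0 := expR_gt0 (t * d 0 i0).
  have E2 : \sum_i (d 0 i - m) * (expR (t * (d 0 i - d 0 i0)) ^+ 2 * a i) =
      - (\sum_i (m - d 0 i) * (expR (t * d 0 i) ^+ 2 * a i)) / expR (t * d 0 i0) ^+ 2.
    rewrite -sumrN mulr_suml; apply: eq_bigr => i _; rewrite mulrBr expRD expRN.
    by field; rewrite gt_eqF.
  rewrite E2 -E mulNr oppr_le0 divr_ge0 ?sqr_ge0 // mulr_ge0 //; last exact: ltW.
  by rewrite subr_ge0.
pose L i := if d 0 i == d 0 i0 then (d 0 i - m) * a i else 0.
have lim : (fun k : nat => \sum_i (d 0 i - m) * (expR (k%:R * (d 0 i - d 0 i0)) ^+ 2 * a i)) @ \oo
    --> \sum_i L i.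
  apply: cvg_finsum => i; rewrite /L /=; have [->|di] := eqVneq (d 0 i) (d 0 i0).
    rewrite (_ : (fun k : nat => _) = fun=> (d 0 i0 - m) * a i); first exact: cvg_cst.
    by apply/funext => k; rewrite subrr mulr0 expR0 expr1n mul1r.
  have dlt : d 0 i - d 0 i0 < 0 by rewrite subr_lt0 lt_neqAle di dM.
  pose f (k : nat) := expR (k%:R * (d 0 i - d 0 i0)).
  have e : f @ \oo --> (0 : R) by exact: cvg_expR_nat.
  have e2 : (fun k : nat => (d 0 i - m) * (f k * f k * a i)) @ \oo --> (d 0 i - m) * (0 * 0 * a i).
    by apply: cvgM; [exact: cvg_cst|apply: cvgM; [exact: cvgM|exact: cvg_cst]].
  by rewrite !mul0r mulr0 in e2.
have : \sum_i L i <= 0.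
  by apply: (cvgr_to_le lim); apply: nearW => k; exact: sum_le.
apply/negP; rewrite -ltNge.
have L0 i : 0 <= L i.
  rewrite /L; case: eqVneq => // ->; rewrite mulr_ge0 ?nsq_ge0 //.
  by rewrite subr_ge0 ltW.
rewrite (bigD1 i0) //= ltr_wpDr //; first by apply: sumr_ge0.
by rewrite /L eqxx mulr_gt0 ?subr_gt0 // lt_neqAle nsq_ge0 andbT eq_sym nsq_eq0.
Qed.

End Orbit.

(** * The moments of the compact orbit *)

Section Orbit.
Variables (R : realType) (n : nat) (G : set 'M[R]_n).
Local Notation C := (Cplx R).
Local Notation vec := (nonzero_vec (K := C) (n := n)).
Hypotheses (G_subgroup : subgroup_of_SL G) (G_closed : closed G)
  (G_polar : G = [set k *m expmx X | k in compactK G & X in sym_part G])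
  (G_irr_C : irreducible_on (@cplx_mx R n n @` G) fullv).
Variable dot : 'M[C]_n -> 'M[C]_n -> R.
Hypothesis dotP : Ad_invariant_scalar_product dot.
Variable mu : projective_space C n -> 'M[R]_n.
Hypothesis muP : gradient_map G dot mu.
Variable O : set (projective_space C n).
Hypothesis O_orbit : compact_proj_orbit (@cplx_mx R n n @` G) O.
Notation ip := (ip dot).
Notation moment := (moment mu).
Implicit Types (v w : vec) (X Y g k : 'M[R]_n).

Lemma top_Gplus U d Y g v w : framed U d Y -> Gplus G Y g -> top U d v ->
  set_val w = cplx_mx g *m set_val v -> top U d w.
Proof.
move=> fY /(GplusP G _ fY)[_ gu] tv wE i j dij.
have -> : cplx_mx U *m set_val w = cplx_mx (frame_coords U g) *m (cplx_mx U *m set_val v).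
  rewrite wE /frame_coords !cplx_mxM !mulmxA -(mulmxA _ _ (cplx_mx U)) -(cplx_mxM U^T U) fY.1.1.
  by rewrite cplx_mx1 mulmx1.
rewrite mxE big1 // => l _; rewrite [X in X * _]mxE.
have [dlt|dle] := ltP (d 0 l) (d 0 j); first by rewrite (tv l j dlt) mulr0.
by rewrite gu ?rmorph0 ?mul0r // (lt_le_trans dij).
Qed.

Lemma ip_moment_top_max U d Y : sym_part G Y -> framed U d Y -> exists M,
  [/\ forall v, ip (moment v) Y <= M, forall v, top U d v <-> ip (moment v) Y = M &
      exists2 v, on_orbit O v & ip (moment v) Y = M].
Proof.
move=> pY fY; have [i0 dM] := max_index G_subgroup O_orbit d.
exists (d 0 i0); split=> [v|v|].
- exact: (ip_moment_le muP v pY fY dM).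
- exact: (topP muP v pY fY dM).
have [v Ov tv] := orbit_top G_subgroup G_irr_C muP O_orbit pY fY.
by exists v => //; apply/(topP muP v pY fY dM).
Qed.

Lemma moment_dist v w : ip (moment w - moment v) (moment w - moment v) =
  ip (moment w) (moment w) - 2 * ip (moment w) (moment v) + ip (moment v) (moment v).
Proof. by rewrite (ip_sqrB dotP) //; exact: (Sym0_moment muP). Qed.

Lemma moment_eq v w : ip (moment w - moment v) (moment w - moment v) <= 0 -> moment w = moment v.
Proof.
move=> h; have sD : Sym0 (moment w - moment v) by apply: Sym0B; exact: (Sym0_moment muP).
apply/eqP; rewrite -subr_eq0; apply/eqP/(ip_eq0 dotP sD)/le_anti.
by rewrite h (ip_ge0 dotP).
Qed.

(** A point of the orbit whose moment [x] has maximal norm also maximizes the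
    height function of [x], and every other maximum of that function has moment [x]. *)
Lemma fibre_of_max v U d : on_orbit O v ->
  (forall w, on_orbit O w -> ip (moment w) (moment w) <= ip (moment v) (moment v)) ->
  framed U d (moment v) ->
  forall w, on_orbit O w -> moment w = moment v <-> top U d w.
Proof.
move=> Ov vmax fv; have pv := moment_sym muP v.
have [M [leM topM [u Ou uM]]] := ip_moment_top_max pv fv.
have le_v w : on_orbit O w -> ip (moment w) (moment v) <= ip (moment v) (moment v).
  move=> Ow; have := ip_ge0 dotP (Sym0B (Sym0_moment muP w) (Sym0_moment muP v)).
  by rewrite moment_dist; have := vmax w Ow; lra.
have vM : ip (moment v) (moment v) = M.
  by apply: le_anti; rewrite leM -uM le_v.
move=> w Ow; split=> [wv|/topM wM]; first by apply/topM; rewrite wv.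
by apply: moment_eq; rewrite moment_dist; have := vmax w Ow; lra.
Qed.

Lemma moment_Kconj k v w : compactK G k -> set_val w = cplx_mx k *m set_val v ->
  moment w = Ad k (moment v).
Proof. exact: (moment_equivariant G_subgroup dotP muP). Qed.

Lemma moment_line v w : line_of v = line_of w -> moment v = moment w.
Proof. by move=> vw; rewrite -[LHS]/(mu (line_of v)) vw. Qed.

(** The fibre over a moment of maximal norm is stable under its parabolic
    [G^{x+}]; since [G = K G^{x+}], all moments of the orbit are [K]-conjugate to it. *)
Lemma moment_orbit : exists2 v, on_orbit O v &
  forall w, on_orbit O w -> exists2 k, compactK G k & moment w = Ad k (moment v).
Proof.
have [v Ov vmax] := orbit_max G_subgroup O_orbit (ip_moment_norm_continuous dotP muP).
have pv := moment_sym muP v; have [U [d fv]] := sym_part_framed pv.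
exists v => // w Ow.
have [g [u [Gg uE /moment_line wu]]] := orbit_transitive G_subgroup O_orbit Ov Ow.
have [k [q [Kk Qq gE]]] := iwasawa G_subgroup G_closed G_polar pv Gg.
have [z zE] := vec_act v (group_unit G_subgroup Qq.1).
have Oz := orbit_stable G_subgroup O_orbit Qq.1 Ov zE.
have fib := fibre_of_max Ov vmax fv.
have zv : moment z = moment v.
  by apply/fib => //; apply: (top_Gplus fv Qq _ zE); apply/fib.
exists k => //; rewrite wu -zv; apply: moment_Kconj => //.
by rewrite uE gE cplx_mxM -mulmxA zE.
Qed.

Lemma moment_norm v w : on_orbit O v -> on_orbit O w ->
  ip (moment v) (moment v) = ip (moment w) (moment w).
Proof.
have [u Ou uK] := moment_orbit => /uK[k Kk ->] /uK[h Kh ->].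
have su := Sym0_moment muP u.
by rewrite (ip_Ad dotP (compactK_SOn Kk)) // (ip_Ad dotP (compactK_SOn Kh)).
Qed.

Lemma moment_fibre v U d : on_orbit O v -> framed U d (moment v) ->
  forall w, on_orbit O w -> moment w = moment v <-> top U d w.
Proof.
by move=> Ov; apply: fibre_of_max => // w Ow; rewrite (moment_norm Ow Ov).
Qed.

Lemma moment_Gplus v w q : on_orbit O v -> Gplus G (moment v) q ->
  set_val w = cplx_mx q *m set_val v -> moment w = moment v.
Proof.
move=> Ov Qq wE; have [U [d fv]] := sym_part_framed (moment_sym muP v).
apply/(moment_fibre Ov fv); first exact: (orbit_stable G_subgroup O_orbit Qq.1 Ov wE).
by apply: (top_Gplus fv Qq _ wE); apply/(moment_fibre Ov fv).
Qed.

(** On the compact orbit the moment map intertwines the projective action of [G]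
    with its action on the [K]-orbit of moments. *)
Theorem Korbit_action_moment g v w : G g -> on_orbit O v ->
  set_val w = cplx_mx g *m set_val v ->
  Korbit_action G (mu @` O) g (moment v) = moment w.
Proof.
move=> Gg Ov wE; apply: xget_unique.
  have [k [q [Kk Qq gE]]] := iwasawa G_subgroup G_closed G_polar (moment_sym muP v) Gg.
  exists (moment v), 1%:M, k; split=> //.
  - by exists (line_of v).
  - by split; [exact: group1 | split; rewrite ?trmx1 ?mulmx1 ?det1].
  - by rewrite Ad1.
  split; last by exists q => //; rewrite mulmx1.
  have [z zE] := vec_act v (group_unit G_subgroup Qq.1).
  rewrite -(moment_Gplus Ov Qq zE); apply: moment_Kconj => //.
  by rewrite wE gE cplx_mxM -mulmxA zE.
move=> y' [_ [k [k' [[x Ox <-] Kk Kk' vx [-> [q Qq gk]]]]]].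
have [u xu] := line_of_surj x; rewrite xu -/(moment u) in Ox vx Qq *.
have Kt := compactK_tr G_subgroup Kk; have [k1 k2] := compactK_orthogonal Kk.
have ku := group_unit G_subgroup Kk.1; have ktu := group_unit G_subgroup Kt.1.
have [z zE] := vec_act v ktu.
have Oz := orbit_stable G_subgroup O_orbit Kt.1 Ov zE.
have mz : moment z = moment u.
  by rewrite (moment_Kconj Kt zE) vx -AdM // k1 Ad1.
rewrite -mz in Qq *; have [z' z'E] := vec_act z (group_unit G_subgroup Qq.1).
rewrite -(moment_Gplus Oz Qq z'E); apply/esym/moment_Kconj => //.
by rewrite z'E zE wE !mulmxA -!cplx_mxM -gk -mulmxA k2 mulmx1.
Qed.

End Orbit.

(** * Faces of the convex hull *)

Section Faces.
Variables (R : realType) (n : nat) (G : set 'M[R]_n).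
Local Notation C := (Cplx R).
Local Notation vec := (nonzero_vec (K := C) (n := n)).
Hypotheses (G_subgroup : subgroup_of_SL G) (G_closed : closed G)
  (G_polar : G = [set k *m expmx X | k in compactK G & X in sym_part G])
  (G_irr_C : irreducible_on (@cplx_mx R n n @` G) fullv).
Variable dot : 'M[C]_n -> 'M[C]_n -> R.
Hypothesis dotP : Ad_invariant_scalar_product dot.
Variable mu : projective_space C n -> 'M[R]_n.
Hypothesis muP : gradient_map G dot mu.
Variable O : set (projective_space C n).
Hypothesis O_orbit : compact_proj_orbit (@cplx_mx R n n @` G) O.
Notation ip := (ip dot).
Notation moment := (moment mu).
Implicit Types (v w : vec) (X Y g k : 'M[R]_n).

Local Notation E := (conv_hull (mu @` O)).

Lemma convex_setP (A : set 'M[R]_n) :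
  (forall x y (t : R), 0 <= t <= 1 -> A x -> A y -> A (t *: x + (1 - t) *: y)) ->
  @convex_set R 'M[R]_n A.
Proof.
move=> cA x y l; rewrite !inE => Ax Ay; apply: cA => //.
by rewrite ge0 le1.
Qed.

Lemma hull_convex x y (t : R) : 0 <= t <= 1 -> E x -> E y -> E (t *: x + (1 - t) *: y).
Proof.
move=> /andP[t0 t1] Ex Ey A [cA SA].
have := cA x y (Itv01 t0 t1); rewrite !inE; apply.
  exact: Ex.
exact: Ey.
Qed.

Lemma hull_sub v : on_orbit O v -> E (moment v).
Proof. by move=> Ov A [_ SA]; apply: SA; exists (line_of v). Qed.

Lemma hull_ind (A : set 'M[R]_n) :
  (forall x y (t : R), 0 <= t <= 1 -> A x -> A y -> A (t *: x + (1 - t) *: y)) ->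
  (forall v, on_orbit O v -> A (moment v)) -> E `<=` A.
Proof.
move=> cA SA x; apply; split; first exact: convex_setP.
by move=> _ [y Oy <-]; have [v yv] := line_of_surj y; rewrite yv in Oy *; exact: SA.
Qed.

Lemma Sym0_segment t X Y : Sym0 X -> Sym0 Y -> Sym0 (t *: X + (1 - t) *: Y).
Proof.
move=> sX sY; apply: Sym0_comb => //; rewrite -[_ *: Y]addr0; apply: Sym0_comb => //.
exact: Sym0_0.
Qed.

Lemma ip_segment t X Y Z : Sym0 X -> Sym0 Y -> Sym0 Z ->
  ip (t *: X + (1 - t) *: Y) Z = t * ip X Z + (1 - t) * ip Y Z.
Proof.
move=> sX sY sZ; have s0 := Sym0_0 R n.
have sY' : Sym0 ((1 - t) *: Y) by rewrite -[_ *: Y]addr0; exact: Sym0_comb.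
rewrite (ip_comb dotP) // -[_ *: Y]addr0 (ip_comb dotP) //.
by rewrite (ip0l dotP) // addr0.
Qed.

Lemma ip_segment_sqr t X Y : Sym0 X -> Sym0 Y ->
  ip (t *: X + (1 - t) *: Y) (t *: X + (1 - t) *: Y) =
  t * ip X X + (1 - t) * ip Y Y - t * (1 - t) * ip (X - Y) (X - Y).
Proof.
move=> sX sY; have sZ := Sym0_segment t sX sY.
rewrite ip_segment // [ip X _](ipC dotP) // [ip Y (_ + _)](ipC dotP) // !ip_segment //.
by rewrite (ip_sqrB dotP) // [ip Y X](ipC dotP) //; ring.
Qed.

Lemma hull_Sym0 : E `<=` @Sym0 R n.
Proof.
apply: hull_ind => [x y t _|v _]; [exact: Sym0_segment | exact: (Sym0_moment muP)].
Qed.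

Lemma hull_le b M : Sym0 b -> (forall v, ip (moment v) b <= M) -> forall x, E x -> ip x b <= M.
Proof.
move=> sb vM x Ex.
have [] : (@Sym0 R n `&` [set x | ip x b <= M]) x; last by [].
move: x Ex; apply: hull_ind => [x y t /andP[t0 t1] [sx xM] [sy yM]|v _].
  split; first exact: Sym0_segment.
  by rewrite /= ip_segment //; move: xM yM => /= xM yM; nra.
by split; [exact: (Sym0_moment muP) | exact: vM].
Qed.

Lemma hull_ball v : on_orbit O v -> forall x, E x -> ip x x <= ip (moment v) (moment v).
Proof.
move=> Ov x Ex.
have [] : (@Sym0 R n `&` [set x | ip x x <= ip (moment v) (moment v)]) x; last by [].
move: x Ex; apply: hull_ind => [x y t /andP[t0 t1] [sx xM] [sy yM]|w Ow].
  split; first exact: Sym0_segment.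
  rewrite /= ip_segment_sqr //; move: xM yM => /= xM yM.
  have := ip_ge0 dotP (Sym0B sx sy) => xy0.
  have : 0 <= t * (1 - t) * ip (x - y) (x - y) by rewrite !mulr_ge0 // subr_ge0.
  by nra.
split; first exact: (Sym0_moment muP).
by rewrite /= (moment_norm G_subgroup G_closed G_polar G_irr_C dotP muP O_orbit Ow Ov).
Qed.

(** The moments of the compact orbit lie on a sphere, so each of them is extreme in
    the hull. Conversely, removing from the hull a point that is extreme in the face,
    hence in the hull, leaves a convex set, which contains the moments if the point
    is not one of them. *)
Lemma extreme_face b U d x : sym_part G b -> framed U d b ->
  extreme_points (exposed_face dot E b) x <->
  exists2 v, on_orbit O v /\ top U d v & x = moment v.
Proof.
move=> pb fb; have sb := sym_part_Sym0 pb.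
have [M [leM topM [u Ou uM]]] := ip_moment_top_max G_subgroup G_irr_C muP O_orbit pb fb.
have faceE y : exposed_face dot E b y <-> E y /\ ip y b = M.
  split=> [[Ey ymax]|[Ey yM]]; split=> //.
    apply: le_anti; rewrite (hull_le sb leM Ey) -uM; apply: ymax; exact: hull_sub.
  by move=> z Ez; rewrite -!/(ip _ _) yM (hull_le sb leM Ez).
split=> [[/faceE[Ex xM] xext]|[v [Ov /topM tv] ->]]; last first.
  split; first by apply/faceE; split => //; exact: hull_sub.
  move=> y z t /faceE[Ey _] /faceE[Ez _] /andP[t0 t1] vyz.
  have sy := hull_Sym0 Ey; have sz := hull_Sym0 Ez.
  have yz : y = z.
    have := hull_ball Ov Ey; have := hull_ball Ov Ez.
    have := ip_ge0 dotP (Sym0B sy sz) => yz0.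
    move: (ip_segment_sqr t sy sz); rewrite -vyz => E1 zr yr.
    have t10 : 0 < t * (1 - t) by rewrite mulr_gt0 // subr_gt0.
    have : t * (1 - t) * ip (y - z) (y - z) <= 0 by nra.
    rewrite pmulr_rle0 // => yz0'; apply/eqP; rewrite -subr_eq0; apply/eqP.
    by apply: (ip_eq0 dotP (Sym0B sy sz)); apply: le_anti; rewrite yz0' yz0.
  by rewrite vyz yz -scalerDl addrC subrK scale1r.
have [[v Ov xv]|nox] := pselect (exists2 v, on_orbit O v & x = moment v).
  by exists v => //; split=> //; apply/topM; rewrite -xv.
suff /(_ x Ex)[_ /(_ erefl)] : E `<=` E `&` [set y | y <> x] by [].
apply: hull_ind => [y z t /andP[t0 t1] [Ey yx] [Ez zx]|v Ov]; last first.
  by split; [exact: hull_sub | move=> /= vx; apply: nox; exists v].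
split; first by apply: hull_convex => //; rewrite t0.
move=> /= xE.
have [tt0|tn0] := eqVneq t 0; first by apply: zx; rewrite -xE tt0 scale0r add0r subr0 scale1r.
have [tt1|tn1] := eqVneq t 1; first by apply: yx; rewrite -xE tt1 subrr scale0r addr0 scale1r.
have tpos : 0 < t by rewrite lt_neqAle eq_sym tn0.
have tlt1 : t < 1 by rewrite lt_neqAle tn1.
have yM := hull_le sb leM Ey; have zM := hull_le sb leM Ez.
have e : t * ip y b + (1 - t) * ip z b = M.
  by rewrite -(ip_segment t (hull_Sym0 Ey) (hull_Sym0 Ez) sb) xE.
have yeM : ip y b = M by nra.
have zeM : ip z b = M by nra.
have Fy : exposed_face dot E b y by apply/faceE.
have Fz : exposed_face dot E b z by apply/faceE.
by apply: yx; have [] := xext y z t Fy Fz _ (esym xE); rewrite ?tpos.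
Qed.

Lemma extreme_face_top b U d v : sym_part G b -> framed U d b -> on_orbit O v ->
  extreme_points (exposed_face dot E b) (moment v) <-> top U d v.
Proof.
move=> pb fb Ov; rewrite (extreme_face _ pb fb); split=> [[w [Ow tw] vw]|tv]; last by exists v.
have [M [_ topM _]] := ip_moment_top_max G_subgroup G_irr_C muP O_orbit pb fb.
by apply/topM; rewrite vw; apply/topM.
Qed.

Definition re_vec v : 'cV[R]_n := map_mx (@re R) (set_val v).
Definition im_vec v : 'cV[R]_n := map_mx (@im R) (set_val v).

Lemma re_cplx_mulmx g (z : 'cV[C]_n) : map_mx (@re R) (cplx_mx g *m z) = g *m map_mx (@re R) z.
Proof.
apply/matrixP => i j; rewrite !mxE re_sum; apply: eq_bigr => k _.
by rewrite !mxE re_toCM.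
Qed.

Lemma im_cplx_mulmx g (z : 'cV[C]_n) : map_mx (@im R) (cplx_mx g *m z) = g *m map_mx (@im R) z.
Proof.
apply/matrixP => i j; rewrite !mxE im_sum; apply: eq_bigr => k _.
by rewrite !mxE im_toCM.
Qed.

Hypotheses (G_connected : connected G) (G_irr_R : irreducible_on G fullv).

(** The real and imaginary parts of the points of the orbit over a face span a
    nonzero [Q(W)]-stable subspace of [W], hence all of [W]. *)
Lemma top_stable_stabilizer b U d (W : {vspace 'cV[R]_n}) h :
  sym_part G b -> framed U d b -> stabilizer G W = Gplus G b ->
  irreducible_on (stabilizer G W) W -> G h ->
  (forall v w, on_orbit O v -> top U d v -> set_val w = cplx_mx h *m set_val v -> top U d w) ->
  stabilizer G W h.
Proof.
move=> pb fb WE Wirr Gh hT.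
pose P (B : {vspace 'cV[R]_n}) := forall v, on_orbit O v -> top U d v ->
  re_vec v \in B /\ im_vec v \in B.
have [||B PB Bmin] := @least_vspace R n P.
- by move=> v _ _; rewrite !memvf.
- move=> V V' PV PV' v Ov tv; have [r1 i1] := PV v Ov tv; have [r2 i2] := PV' v Ov tv.
  by rewrite !memv_cap r1 r2 i1 i2.
have B_stable g : G g -> (forall v w, on_orbit O v -> top U d v ->
    set_val w = cplx_mx g *m set_val v -> top U d w) -> forall x, x \in B -> g *m x \in B.
  move=> Gg gT; have gu := group_unit G_subgroup Gg.
  apply: (act_vspaceV_stable gu); apply: Bmin => v Ov tv.
  have [w wE] := vec_act v gu; have tw := gT v w Ov tv wE.
  have [rw iw] := PB w (orbit_stable G_subgroup O_orbit Gg Ov wE) tw.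
  by split; apply: mem_act_vspace_invmx => //; rewrite -?re_cplx_mulmx -?im_cplx_mulmx -wE.
have BW : (B <= W)%VS.
  apply: Bmin => v Ov tv; split;
    apply/(admissible_top G_subgroup G_closed G_connected G_polar G_irr_R pb fb WE Wirr) => i j dij;
    rewrite /re_vec /im_vec -?re_cplx_mulmx -?im_cplx_mulmx mxE (tv i j dij) //.
have [] := Wirr.2 B BW.
- move=> g Sg; apply/act_vspace_subP; apply: B_stable; first by case: Sg.
  by move=> v w _ tv wE; apply: (top_Gplus (G := G) fb _ tv wE); rewrite -WE.
- move=> B0; have [v Ov tv] := orbit_top G_subgroup G_irr_C muP O_orbit pb fb.
  have [] := PB v Ov tv; rewrite B0 !memv0 => /eqP/matrixP rv /eqP/matrixP iv.
  case/eqP: (vec_neq0 v); apply/matrixP => i j; rewrite [RHS]mxE; apply/eqP; rewrite -nsq_eq0.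
  by have := rv i j; have := iv i j; rewrite !mxE /nsq => -> ->; rewrite expr0n addr0.
- move=> BE; split=> //; apply: act_vspace_eq; first exact: (group_unit G_subgroup Gh).
  by rewrite -BE; exact: B_stable.
Qed.

(** Both groups are the stabilizer of the set of points of the orbit over the face. *)
Theorem Q_face_stabilizer b (W : {vspace 'cV[R]_n}) :
  sym_part G b -> stabilizer G W = Gplus G b -> irreducible_on (stabilizer G W) W ->
  Q_face G (mu @` O) (exposed_face dot E b) = stabilizer G W.
Proof.
move=> pb WE Wirr; have [U [d fb]] := sym_part_framed pb.
have act := Korbit_action_moment G_subgroup G_closed G_polar G_irr_C dotP muP O_orbit.
have QT h v w : Gplus G b h -> on_orbit O v -> top U d v ->
    set_val w = cplx_mx h *m set_val v -> on_orbit O w /\ top U d w.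
  move=> Qh Ov tv wE; split; first exact: (orbit_stable G_subgroup O_orbit Qh.1 Ov wE).
  exact: (top_Gplus fb Qh tv wE).
apply/seteqP; split=> h.
  move=> [Gh hF]; apply: (top_stable_stabilizer pb fb WE Wirr Gh) => v w Ov tv wE.
  apply/(extreme_face_top pb fb); first exact: (orbit_stable G_subgroup O_orbit Gh Ov wE).
  rewrite -(act _ _ _ Gh Ov wE) -[X in X _]hF; exists (moment v) => //.
  exact/(extreme_face_top pb fb).
move=> Sh; have Qh : Gplus G b h by rewrite -WE.
have QVh := GplusV G_subgroup WE Qh.
have hu := group_unit G_subgroup Qh.1.
split; first by case: Sh.
apply/seteqP; split=> [_ [_ /(extreme_face _ pb fb)[v [Ov tv] ->] <-]|].
  have [w wE] := vec_act v hu; rewrite (act _ _ _ Qh.1 Ov wE).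
  have [Ow tw] := QT _ _ _ Qh Ov tv wE.
  by apply/(extreme_face _ pb fb); exists w.
move=> _ /(extreme_face _ pb fb)[w [Ow tw] ->].
have [v vE] := vec_act w (group_unit G_subgroup QVh.1).
have [Ov tv] := QT _ _ _ QVh Ow tw vE.
exists (moment v); first by apply/(extreme_face _ pb fb); exists v.
by apply: act => //; [exact: Qh.1 | rewrite vE mulmxA -cplx_mxM mulmxV // cplx_mx1 mul1mx].
Qed.

Lemma Ad_linear (k : 'M[R]_n) t (x y : 'M[R]_n) :
  Ad k (t *: x + (1 - t) *: y) = t *: Ad k x + (1 - t) *: Ad k y.
Proof. by rewrite /Ad mulmxDr mulmxDl -!scalemxAr -!scalemxAl. Qed.

Lemma hull_Ad (k : 'M[R]_n) x : compactK G k -> E x -> E (Ad k x).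
Proof.
move=> Kk Ex; suff /(_ x Ex) : E `<=` [set x | E (Ad k x)] by [].
apply: hull_ind => [y z t t01 Ey Ez|v Ov]; first by rewrite /= Ad_linear; exact: hull_convex.
have [w wE] := vec_act v (group_unit G_subgroup Kk.1).
rewrite /= -(moment_equivariant G_subgroup dotP muP Kk wE); apply: hull_sub.
exact: (orbit_stable G_subgroup O_orbit Kk.1 Ov wE).
Qed.

Lemma face_Ad (k : 'M[R]_n) b x : sym_part G b -> compactK G k -> Ad k b = b ->
  exposed_face dot E b x -> exposed_face dot E b (Ad k x).
Proof.
move=> pb Kk kb [Ex xmax]; split; first exact: hull_Ad.
have kx : ip (Ad k x) b = ip x b.
  rewrite -{1}kb (ip_Ad dotP (compactK_SOn Kk)) //; first exact: hull_Sym0.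
  exact: sym_part_Sym0 pb.
by move=> y /xmax; rewrite -!/(ip _ _) kx.
Qed.

Lemma H_face_centralizer (k : 'M[R]_n) b : sym_part G b -> compactK G k -> Ad k b = b ->
  H_face G (exposed_face dot E b) k.
Proof.
move=> pb Kk kb; have Kt := compactK_tr G_subgroup Kk.
have [k1 k2] := compactK_orthogonal Kk.
have ku := group_unit G_subgroup Kk.1; have ktu := group_unit G_subgroup Kt.1.
split=> //; apply/seteqP; split=> [_ [x Fx <-]|x Fx]; first exact: face_Ad.
exists (Ad k^T x); last by rewrite -AdM // k2 Ad1.
by apply: face_Ad => //; rewrite -[in LHS]kb -AdM // k1 Ad1.
Qed.

Lemma Gplus_centralizerM (k q b : 'M[R]_n) : sym_part G b -> compactK G k -> Ad k b = b ->
  Gplus G b q -> Gplus G b (k *m q).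
Proof.
move=> pb Kk kb; have [U [d fb]] := sym_part_framed pb.
move=> /(GplusP G _ fb)[Gq qu]; apply/(GplusP G _ fb); split.
  by apply: groupM => //; case: Kk.
have [k1 k2] := compactK_orthogonal Kk.
have comm : k *m b = b *m k.
  by rewrite -{2}kb (Ad_compactK G_subgroup _ Kk) -mulmxA k1 mulmx1.
have kd i l : d 0 i != d 0 l -> frame_coords U k i l = 0.
  move=> dil.
  have /matrixP/(_ i l) : frame_coords U (k *m b) = frame_coords U (b *m k) by rewrite comm.
  rewrite !(frame_coordsM _ _ fb.1) (frame_coords_framed fb) mul_mx_diag mul_diag_mx.
  rewrite [LHS]mxE [RHS]mxE mulrC => /eqP; rewrite -subr_eq0 -mulrBl mulf_eq0.
  by rewrite subr_eq0 eq_sym (negbTE dil) => /eqP.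
move=> i j dij; rewrite (frame_coordsM _ _ fb.1) mxE big1 // => l _.
have [dil|dil] := eqVneq (d 0 i) (d 0 l); last by rewrite kd ?mul0r.
by rewrite qu ?mulr0 // -dil.
Qed.

(** If [F] is exposed by [b] and also by [b'], and [H_F] fixes [b'], then
    [G^{b'+} = Q(W)]: one inclusion because [G^{b'+}] preserves the points of the
    orbit over [F], the other because [Q(W) = (K cap Q(W)) G^{b'+}] and
    [K cap Q(W)], which centralizes [b], is contained in [H_F]. *)
Theorem C_face_fixed_Gplus b b' (W : {vspace 'cV[R]_n}) :
  sym_part G b -> stabilizer G W = Gplus G b -> irreducible_on (stabilizer G W) W ->
  C_face_fixed G dot E (exposed_face dot E b) b' -> Gplus G b' = stabilizer G W.
Proof.
move=> pb WE Wirr [[pb' FE] b'_fixed].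
have [U [d fb]] := sym_part_framed pb; have [U' [d' fb']] := sym_part_framed pb'.
have topE v : on_orbit O v -> top U d v <-> top U' d' v.
  move=> Ov; rewrite -(extreme_face_top pb fb Ov) -(extreme_face_top pb' fb' Ov).
  by move: FE => /= ->.
have sub : Gplus G b' `<=` stabilizer G W.
  move=> g Qg; apply: (top_stable_stabilizer pb fb WE Wirr Qg.1) => v w Ov tv wE.
  apply/topE; first exact: (orbit_stable G_subgroup O_orbit Qg.1 Ov wE).
  by apply: (top_Gplus fb' Qg _ wE); apply/topE.
apply/seteqP; split=> // g Sg.
have [k [q [Kk Qq gE]]] := iwasawa G_subgroup G_closed G_polar pb' Sg.1.
have Qk : Gplus G b k.
  have qu := group_unit G_subgroup Qq.1; have Qbq : Gplus G b q by rewrite -WE; exact: sub.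
  have Qbqv := GplusV G_subgroup WE Qbq; have ku := group_unit G_subgroup Kk.1.
  have kE : k = g *m invmx q by rewrite gE mulmxK.
  rewrite -WE; split; first by case: Kk.
  apply: act_vspace_eq => // x xW; rewrite kE -mulmxA.
  by apply: (Gplus_stab WE); [rewrite -WE | exact: (Gplus_stab WE Qbqv)].
have kb := compactK_Gplus_commute G_subgroup pb Kk Qk.
rewrite gE; apply: Gplus_centralizerM => //; apply: b'_fixed.
exact: H_face_centralizer.
Qed.

End Faces.

Theorem proposition55 (R : realType) (n : nat) (G : set 'M[R]_n)
  (G_subgroup : subgroup_of_SL G)
  (G_closed : closed G) (G_connected : connected G) (G_noncompact : ~ compact G)
  (G_semisimple : lie_semisimple (lie_algebra G))
  (G_polar : G = [set k *m expmx X | k in compactK G & X in sym_part G])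
  (G_irr_R : irreducible_on G fullv)
  (G_irr_C : irreducible_on (@cplx_mx R n n @` G) fullv)
  (dot : 'M[Cplx R]_n -> 'M[Cplx R]_n -> R)
  (dot_scalar_product : Ad_invariant_scalar_product dot)
  (mu : projective_space (Cplx R) n -> 'M[R]_n)
  (mu_gradient_map : gradient_map G dot mu)
  (O' O : set (projective_space (Cplx R) n))
  (O'_compact_orbit : compact_proj_orbit (zariski_closureC G) O')
  (O_compact_orbit : compact_proj_orbit (@cplx_mx R n n @` G) O)
  (O_sub_O' : O `<=` O') :
  let E := conv_hull (mu @` O) in
  (forall (W : {vspace 'cV[R]_n}) (F : set 'M[R]_n),
     rho_admissible G W -> associated_face G dot E W F ->
     Q_face G (mu @` O) F = stabilizer G W /\
     forall b, C_face_fixed G dot E F b -> Gplus G b = stabilizer G W) /\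
  (forall (W1 W2 : {vspace 'cV[R]_n}) (F : set 'M[R]_n),
     rho_admissible G W1 -> rho_admissible G W2 ->
     associated_face G dot E W1 F -> associated_face G dot E W2 F ->
     stabilizer G W1 = stabilizer G W2).
Proof.
move=> E; have Qface W F : rho_admissible G W -> associated_face G dot E W F ->
    Q_face G (mu @` O) F = stabilizer G W.
  by move=> [_ Wirr] [b [pb WE ->]]; exact: (Q_face_stabilizer G_subgroup G_closed G_polar
    G_irr_C dot_scalar_product mu_gradient_map O_compact_orbit G_connected G_irr_R).
split=> [W F Wadm FW|W1 W2 F W1adm W2adm F1 F2]; last by rewrite -(Qface W1 F) // (Qface W2 F).
split=> [|b' b'F]; first exact: Qface.
have [_ Wirr] := Wadm; have [b [pb WE FE]] := FW; rewrite FE in b'F.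
exact: (C_face_fixed_Gplus G_subgroup G_closed G_polar G_irr_C dot_scalar_product mu_gradient_map
  O_compact_orbit G_connected G_irr_R pb WE Wirr b'F).
Qed.
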